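(* Let $k\ge 1$ and $a\ge2$ be integers, $R=\mathbb{Z}/a\mathbb{Z}$, $\alpha\in(0,1/2]$, and let $G_1,\dots,G_k$ be finite abelian groups whose exponents divide $a$. Then there exist constants $K,c>0$ depending only on $k,\alpha,G_1,\dots,G_k,a$ such that for every $n\ge 1$, if $M_1,\dots,M_k$ are independent random elements of $\mathrm{Mat}_n(R)$ with iid entries which are copies of some $\alpha$-balanced $R$-valued random variable $\xi$, then $$\Big|\mathbf{E}\big[\#\mathrm{Sur}(R^n/M_1R^n,G_1)\times\cdots\times\#\mathrm{Sur}(R^n/M_1\cdots M_kR^n,G_k)\big]-m_k(G_1,\dots,G_k)\Big|\le Ke^{-cn}.$$
   Context: For $\alpha\in(0,1/2]$, an $R$-valued random variable $\xi$ (with $R=\mathbb{Z}/a\mathbb{Z}$) is $\alpha$-balanced if for every prime $p\mid a$, $\max_{r\in\mathbb{Z}/p\mathbb{Z}}\mathbf{P}(\xi\equiv r\bmod p)\le 1-\alpha$. $\mathrm{Sur}(A,B)$ is the set of surjective group homomorphisms $A\to B$. For finite abelian groups $G_1,\dots,G_k$, let $\pi_i$ denote projection onto the summand $G_i$ and $\pi_I$ projection onto $\bigoplus_{i\in I}G_i$. Then $m_k(G_1,\dots,G_k)$ is the number of sequences $(H_1,\dots,H_k)$ such that $H_k=G_k$ and for each $i=1,\dots,k-1$: $H_i\le G_i\oplus\cdots\oplus G_k$, $\pi_i(H_i)=G_i$, and $\pi_{\{i+1,\dots,k\}}(H_i)\le H_{i+1}$. *)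

(* Defs.v *)
From HB Require Import structures.
From mathcomp Require Import all_boot all_order all_algebra.
From mathcomp Require Import all_fingroup all_solvable.
From mathcomp Require Import all_classical all_reals all_analysis.

Set Implicit Arguments.
Unset Strict Implicit.
Unset Printing Implicit Defensive.

Import Order.TTheory GRing.Theory Num.Theory.

(* The surjective group homomorphisms A -> B; both groups are the full carrier
   types, written multiplicatively. *)
Definition Sur (A B : finGroupType) : {set {ffun A -> B}} :=
  [set f : {ffun A -> B} |
    [forall x, forall y, f (x * y)%g == (f x * f y)%g]
    && [forall b, exists x, f x == b]].

Section Cokernel.
Variables (a n : nat).
Local Open Scope ring_scope.

Definition mximg (M : 'M['Z_a]_n) : {set 'cV['Z_a]_n} :=
  [set M *m x | x : 'cV['Z_a]_n].

Lemma mximg_group_set M : group_set (mximg M).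
Proof.
apply/group_setP; split; first by apply/imsetP; exists 0; rewrite ?mulmx0.
move=> _ _ /imsetP[x _ ->] /imsetP[y _ ->].
by apply/imsetP; exists (x + y); rewrite ?mulmxDr.
Qed.

Canonical mximg_group M := Group (mximg_group_set M).

(* The carrier of [coset_of H] consists of the cosets of H in its normaliser,
   which here is all of R^n; see [coker_full]. *)
Definition coker (M : 'M['Z_a]_n) : finGroupType := coset_of (mximg M).

Lemma coker_full M : ([set: 'cV['Z_a]_n] / mximg M)%g = [set: coker M].
Proof.
apply/setP => q; rewrite [RHS]inE.
by have [x Nx ->] := cosetP q; apply: mem_quotient; rewrite inE.
Qed.

End Cokernel.

Section Chains.
Variables (k : nat) (G : 'I_k -> finGroupType).

Let sumG : finGroupType := {dffun forall j : 'I_k, G j}.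

(* The partial sum over a set I of indices is identified with the subgroup of
   the full sum of all G_j consisting of the elements supported on I. *)
Definition psum (I : {set 'I_k}) : {set sumG} :=
  [set x : sumG | [forall j, (j \notin I) ==> (x j == 1%g)]].

Definition proj_on (I : {set 'I_k}) (x : sumG) : sumG :=
  [ffun j => if j \in I then x j else 1%g].

(* Indices are 0-based: [i.+1 == k :> nat] singles out the last one. *)
Definition is_chain (H : {ffun 'I_k -> {group sumG}}) : bool :=
  [forall i : 'I_k,
    if i.+1 == k then (H i : {set sumG}) == psum [set i]
    else [&& H i \subset psum [set j : 'I_k | i <= j],
             [set x i | x : sumG in H i] == [set: G i]
           & [forall j : 'I_k, (j == i.+1 :> nat) ==>
               (proj_on [set l : 'I_k | i < l] @: H i \subset H j)]]].

Definition m_chains : nat := #|[set H | is_chain H]|.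

End Chains.

Section Randomness.
Local Open Scope classical_set_scope.
Local Open Scope ring_scope.
Local Open Scope ereal_scope.
Context (d : measure_display) (T : measurableType d) (R : realType)
  (P : probability T R).

(* Random elements of a finite set with its discrete sigma-algebra. *)
Definition finite_rv (F : finType) (X : T -> F) : Prop :=
  forall x : F, measurable [set t | X t = x].

Definition indep_rvs (I F : finType) (X : I -> T -> F) : Prop :=
  forall (J : {set I}) (B : I -> {set F}),
    P [set t | forall i, i \in J -> X i t \in B i]
    = \prod_(i in J) P [set t | X i t \in B i].

Definition balanced (a : nat) (alpha : R) (xi : T -> 'Z_a) : Prop :=
  forall p : nat, prime p -> (p %| a)%N ->
    \big[maxe/-oo]_(r < p) P [set t | (xi t = r %[mod p])%N] <= (1 - alpha)%:E.

End Randomness.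

Definition identically_distributed (d1 d2 : measure_display)
  (T1 : measurableType d1) (T2 : measurableType d2) (R : realType)
  (P1 : probability T1 R) (P2 : probability T2 R) (F : finType)
  (X : T1 -> F) (Y : T2 -> F) : Prop :=
  forall x : F, P1 [set t | X t = x]%classic = P2 [set t | Y t = x]%classic.

(* Main.v *)
Require Import Defs.
From HB Require Import structures.
From mathcomp Require Import all_boot all_order all_algebra.
From mathcomp Require Import all_fingroup all_solvable.
From mathcomp Require Import all_classical all_reals all_analysis.
From mathcomp Require Import measurable_realfun ring lra zify.

(* A surjection R^n / M_1 ... M_i R^n -> G_i is a vector F_i of n generators of
   G_i killed by (M_1 ... M_i)^T; as a square matrix over Z/a is equivalent to
   its transpose, one may count the generating F_i with M_1 ... M_i F_i = 0.
   Put X_i = (M_(i+1) ... M_j F_j)_(j >= i), a vector over G_i + ... + G_k.  The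
   conditions become M_1 X_1 = 0 and M_(i+1) X_(i+1) = pi_{>i} X_i, so
   the expectation is a sum over (X_1, ..., X_k) of products of transition
   probabilities, and the groups H_i generated by the X_i form a chain whenever
   the product is nonzero.  Summing over X_k first, then X_(k-1), and so on, each
   chain contributes 1 + O(e^(-cn)), because for every vector Y over H

     sum over X generating H of P(M X = Y) = 1 + O(e^(-cn)).

   To see this, attach to X the smallest K <= H containing most entries of X.
   The entries in K equidistribute in K.  If K = H this gives
   P(M X = Y) = |H|^(-n) (1 + O(e^(-cn))), and almost all X are of this kind.  If
   K < H, the remaining entries cost a factor 1 - alpha for each of the n rows of
   M, which beats the entropy of choosing X. *)

(** The constants must not depend on xi, and balancedness only constrains residues modulo primes.
    Two facts bridge the gap. If x is outside K, requiring r x to lie in a given coset of K fixes r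
    modulo some prime divisor of a. And the residues of probability at least alpha / (2a) have
    differences that generate Z/a, so mixing rates depend on alpha and a alone.

    How many entries count as most is calibrated by a parameter D: at most n / (D #|K|) entries may
    lie outside K. For D large at most (#|K| (1 + eta)^2)^n vectors are of this kind, while for K <
    H each is sent to Y with probability at most about (#|K|^(-1) (1 - alpha))^n. The powers of #|K|
    cancel, and eta is chosen with (1 - alpha) (1 + eta)^2 < 1.

    As n coordinates are treated at once, the equidistribution error of a single one must be
    exponentially small in n. This takes linearly many copies of each of some generators of K, which
    minimality of K provides. *)

Set Implicit Arguments.
Unset Strict Implicit.
Unset Printing Implicit Defensive.

Import Order.TTheory GRing.Theory Num.Theory.
Local Open Scope ring_scope.

(** * The law of a random combination *)

Section Law.
Variables (R : realFieldType) (a : nat) (q : 'Z_a -> R).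
Hypotheses (q_ge0 : forall r, 0 <= q r) (q_sum : \sum_r q r = 1).

(* [law s y] is the probability that [\sum_i xi_i *: s_i = y], for independent
   [xi_i] with weights [q]. *)
Fixpoint law (V : finLmodType 'Z_a) (s : seq V) (y : V) : R :=
  if s is x :: s' then \sum_r q r * law s' (y - r *: x) else (y == 0)%:R.

Section LawTheory.
Variable V : finLmodType 'Z_a.
Implicit Types (s t : seq V) (x y z : V) (K : {group V}).

Lemma law_ge0 s y : 0 <= law s y.
Proof.
elim: s y => [|x s IHs] y /=; first exact: ler0n.
by apply: sumr_ge0 => r _; rewrite mulr_ge0.
Qed.

Lemma sum_law s : \sum_y law s y = 1.
Proof.
elim: s => [|x s IHs] /=.
  by rewrite (bigD1 0) //= eqxx big1 ?addr0 // => y /negPf->.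
rewrite exchange_big -[RHS]q_sum /=; apply: eq_bigr => r _.
rewrite -mulr_sumr (reindex_inj (addIr (r *: x))) /=.
by under eq_bigr do rewrite addrK; rewrite IHs mulr1.
Qed.

Lemma law_le1 s y : law s y <= 1.
Proof.
rewrite -(sum_law s) (bigD1 y) //= lerDl.
by apply: sumr_ge0 => z _; apply: law_ge0.
Qed.

Lemma law_cat s t y : law (s ++ t) y = \sum_z law s z * law t (y - z).
Proof.
elim: s y => [|x s IHs] y /=.
  rewrite (bigD1 0) //= eqxx mul1r subr0 big1 ?addr0 // => z /negPf->.
  by rewrite mul0r.
under [RHS]eq_bigr do rewrite mulr_suml.
rewrite exchange_big /=; apply: eq_bigr => r _.
rewrite IHs mulr_sumr [RHS](reindex_inj (addIr (r *: x))) /=.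
by apply: eq_bigr => z _; rewrite addrK mulrA [z + _]addrC opprD addrA.
Qed.

Lemma law_catC s t : law (s ++ t) =1 law (t ++ s).
Proof.
move=> y; rewrite !law_cat (reindex_inj (inj_comp (addrI y) (@oppr_inj _))) /=.
by apply: eq_bigr => z _; rewrite mulrC subKr.
Qed.

Lemma law_perm s t : perm_eq s t -> law s =1 law t.
Proof.
move=> eq_st; apply: (catCA_perm_ind (P := fun t => law s =1 law t)) eq_st _ => //.
move=> s1 s2 s3 law_s y.
rewrite law_s !catA law_cat [RHS]law_cat.
by apply: eq_bigr => z _; rewrite law_catC.
Qed.

Lemma law_supp K s y : {subset s <= K} -> y \notin K -> law s y = 0.
Proof.
elim: s y => [|x s IHs] y sK nKy /=.
  by case: eqP nKy => // ->; rewrite (group1 K).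
rewrite big1 // => r _; rewrite IHs ?mulr0 // => [z zs|].
  by apply: sK; rewrite inE zs orbT.
apply: contra nKy => yK; rewrite -(subrK (r *: x) y).
apply: (groupM yK); rewrite -[r]natr_Zp scaler_nat.
by apply: (groupX r (sK x _)); rewrite mem_head.
Qed.

(** The N copies of x contribute t *: x, where t is a sum of N independent coefficients. Mixing thus
    has to be studied only in Z/a, and the law of t is again an instance of [law], in the regular
    module. *)
Lemma law_nseq N x s y :
  law (nseq N x ++ s) y
  = \sum_(t : 'Z_a) law (nseq N (1 : ('Z_a)^o)) t * law s (y - t *: x).
Proof.
elim: N y => [|N IHN] y /=.
  rewrite (bigD1 0) //= mul1r scale0r subr0 big1 ?addr0 // => t /negPf->.
  by rewrite mul0r.
under [RHS]eq_bigr do rewrite mulr_suml.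
rewrite exchange_big /=; apply: eq_bigr => r _.
rewrite IHN mulr_sumr [RHS](reindex_inj (addIr r)) /=.
apply: eq_bigr => t _; rewrite -mulrA.
have ->: t + r - r *: (1 : ('Z_a)^o) = t by rewrite /GRing.scale /= mulr1 addrK.
by rewrite scalerDl opprD addrA addrAC.
Qed.

End LawTheory.
End Law.

(** The order of x modulo K exceeds 1 and divides a, and (r - r') x lies in K only if that order
    divides r - r'; any prime factor of the order serves as p. *)
Lemma prime_separation (a : nat) (V : finLmodType 'Z_a) (K : {group V}) (x : V) :
    (1 < a)%N -> x \notin K ->
  exists2 p : nat, prime p && (p %| a)%N &
    forall r r' : 'Z_a, r *: x - r' *: x \in K -> r = r' %[mod p].
Proof.
move=> a_gt1 nKx.
have Nx z : z \in 'N(K)%g.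
  by apply: (fintype.subsetP (cent_sub _)); apply/centP => y _; apply: FinRing.zmod_mulgC.
pose o := #[coset K x]%g.
have oP m : (o %| m)%N = (x *+ m \in K).
  rewrite order_dvdn -morphX ?Nx // FinRing.zmodXgE.
  by apply/eqP/idP => [/coset_idr->|/coset_id].
have o_neq1 : o != 1%N.
  by rewrite -dvdn1 oP mulr1n.
exists (pdiv o); first (apply/andP; split).
- by rewrite pdiv_prime // ltn_neqAle eq_sym o_neq1 order_gt0.
- apply: dvdn_trans (pdiv_dvd o) _; rewrite oP -scaler_nat.
  by rewrite pchar_Zp ?scale0r ?(group1 K).
have sep (r r' : 'Z_a) : (r' <= r)%N -> r *: x - r' *: x \in K -> r = r' %[mod pdiv o].
  move=> le_r Kr; apply/eqP; rewrite eqn_mod_dvd //.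
  apply: dvdn_trans (pdiv_dvd o) _; rewrite oP mulrnBr //.
  by rewrite -!scaler_nat !natr_Zp.
move=> r r'; case/orP: (leq_total r' r) => le_r Kr; first exact: sep.
by apply/esym/sep => //; rewrite -opprB; apply: (groupVr Kr).
Qed.

(** One length serves all of the finitely many A, since adjoining 1 pads shorter words. Uniformity
    matters because A will depend on the weights or on the vector X. *)
Lemma bounded_generation (gT : finGroupType) :
  exists2 L : nat, (0 < L)%N &
    forall (A : {set gT}) x, x \in <<A>>%g -> x \in ((1 |: A) ^+ L)%g.
Proof.
pose s (A : {set gT}) := sval (gen_expgs A).
exists (\max_A s A).+1 => // A x.
rewrite (svalP (gen_expgs A)) -/(s A).
have /subnKC <- : (s A <= (\max_A s A).+1)%N by rewrite leqW ?leq_bigmax.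
move: (_ - _)%N => m xA; rewrite expgD -[x]mulg1 mem_mulg //.
elim: m => [|m IHm]; first by rewrite expg0 set11.
by rewrite expgS -[X in X \in _]mulg1 mem_mulg ?setU11.
Qed.

Lemma walk_bound (R : realFieldType) (V : finZmodType) (f : V -> R) (e : R)
    (A : {set V}) m g :
    0 <= e -> (forall x y, x \in A -> `|f (y + x) - f y| <= e) ->
  g \in ((1 |: A) ^+ m)%g -> forall y, `|f (y + g) - f y| <= m%:R * e.
Proof.
move=> e_ge0 fA; elim: m g => [|m IHm] g.
  by rewrite expg0 => /set1P-> y; rewrite addr0 subrr normr0 mul0r.
rewrite expgS => /mulsgP[b g' Ab Ag' ->] y.
have ->: (b * g')%g = b + g' by [].
rewrite addrA -(subrKA (f (y + b))) (le_trans (ler_normD _ _)) //.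
rewrite -addn1 natrD mulrDl mul1r lerD ?IHm //.
by case/setU1P: Ab => [->|/fA//]; rewrite addr0 subrr normr0.
Qed.

(** * Mixing and equidistribution for balanced weights *)

Definition balanced_weights (R : realFieldType) (a : nat) (alpha : R)
    (q : 'Z_a -> R) : Prop :=
  [/\ forall r, 0 <= q r, \sum_r q r = 1 &
      forall p c : nat, prime p -> (p %| a)%N ->
        \sum_(r : 'Z_a | (r == c %[mod p])%N) q r <= 1 - alpha].

Section Mixing.
Variables (R : realFieldType) (a : nat) (alpha : R) (q : 'Z_a -> R).
Hypotheses (a_gt1 : (1 < a)%N) (alpha_gt0 : 0 < alpha) (alpha_le1 : alpha <= 1).
Hypothesis q_bal : balanced_weights alpha q.

(** The residues below this threshold carry at most alpha / 2 of the mass. The others keep more than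
    1 - alpha, the maximum allowed for one class modulo a prime divisor of a. *)
Let gam : R := alpha / (2 * a%:R).
Let S : {set 'Z_a} := [set r | gam <= q r].

Let q_ge0 r : 0 <= q r. Proof. by case: q_bal. Qed.
Let q_sum : \sum_r q r = 1. Proof. by case: q_bal. Qed.
Let a_gt0 : 0 < a%:R :> R. Proof. by rewrite ltr0n ltnW. Qed.
Let gam_gt0 : 0 < gam. Proof. by rewrite divr_gt0 // mulr_gt0. Qed.

Lemma heavy_mass : 1 - alpha < \sum_(r in S) q r.
Proof.
have : \sum_(r | r \notin S) q r <= \sum_(r : 'Z_a) gam.
  rewrite [leRHS](bigID (mem S)) /=; apply: ler_wpDl.
    by apply: sumr_ge0 => r _; apply: ltW.
  by apply: ler_sum => r; rewrite inE -ltNge => /ltW.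
rewrite sumr_const card_ord -[gam *+ _]mulr_natr.
have ->: (Zp_trunc a).+2%:R = a%:R :> R by rewrite Zp_cast.
have ->: gam * a%:R = alpha / 2 by rewrite /gam; field; rewrite gt_eqF.
have q1 : \sum_(r in S) q r + \sum_(r | r \notin S) q r = 1.
  by rewrite -q_sum [RHS](bigID (mem S)).
by move: q1 alpha_gt0; lra.
Qed.

(** As the number of summands is fixed, one follows words in the differences r - s0: the letter 0 is
    realised by drawing s0 itself, and the total is displaced by m times s0. Each letter has
    probability at least [gam]. *)
Lemma law_nseq_lower s0 m (t : ('Z_a)^o) : s0 \in S ->
  t \in ((1 |: [set (r - s0 : ('Z_a)^o) | r in S]) ^+ m)%g ->
  gam ^+ m <= law q (nseq m (1 : ('Z_a)^o)) (t + s0 *+ m).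
Proof.
move=> Ss0; elim: m t => [|m IHm] t.
  by rewrite expg0 => /set1P->; rewrite mulr0n addr0 /= expr0.
rewrite expgS => /mulsgP[b g' Ab Ag' ->] /=.
have [r Sr ->] : exists2 r, r \in S & b = r - s0.
  case/setU1P: Ab => [->|/imsetP[r Sr ->]]; last by exists r.
  by exists s0; rewrite ?subrr.
rewrite (bigD1 r) //= ler_wpDr //.
  by apply: sumr_ge0 => i _; rewrite mulr_ge0 // law_ge0.
rewrite exprS; have:= Sr; rewrite inE => gam_r.
apply: ler_pM; rewrite ?exprn_ge0 ?(ltW gam_gt0) //.
rewrite [X in law _ _ X](_ : _ = (g' : ('Z_a)^o) + s0 *+ m); first exact: IHm.
rewrite {1}/GRing.scale /= mulr1 mulrS.
by move: (s0 *+ m) => z; change (r - s0 + g' + (s0 + z) - r = g' + z :> 'Z_a); ring.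
Qed.

(** If 1 were outside the generated subgroup, all heavy residues would agree with s0 modulo some
    prime divisor of a, and their mass would be at most 1 - alpha. *)
Lemma heavy_gen s0 : s0 \in S ->
  <<[set (r - s0 : ('Z_a)^o) | r in S]>>%g = [set: ('Z_a)^o].
Proof.
move=> Ss0; set K := <<_>>%g.
have [K1|nK1] := boolP ((1 : ('Z_a)^o) \in K).
  apply/setP => t; rewrite inE -[t]mulr1 -[t in t * _]natr_Zp mulr_natl.
  exact: groupX.
have [p /andP[p_pr p_a] sep] := prime_separation a_gt1 nK1.
have [_ _ /(_ p s0 p_pr p_a)] := q_bal.
rewrite leNgt => /negP[]; apply: lt_le_trans heavy_mass _.
rewrite [leRHS]big_mkcond [leLHS]big_mkcond; apply: ler_sum => r _.
case: ifP => [Sr|_]; last by case: ifP.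
rewrite ifT //; apply/eqP/sep; rewrite /GRing.scale /= !mulr1.
by apply: mem_gen; apply: imset_f.
Qed.

(** A block of L summands reaches every residue with probability at least gam^L, so each complete
    block shrinks the oscillation; the remaining N mod L summands only get the trivial bound 1. *)
Lemma law_nseq_contract L : (0 < L)%N ->
    (forall (A : {set ('Z_a)^o}) x, x \in <<A>>%g -> x \in ((1 |: A) ^+ L)%g) ->
  forall N r r', `|law q (nseq N (1 : ('Z_a)^o)) r - law q (nseq N (1 : ('Z_a)^o)) r'|
     <= (1 - gam ^+ L) ^+ (N %/ L).
Proof.
move=> L_gt0 genL.
have [s0 Ss0] : exists s0, s0 \in S.
  apply/set0Pn; apply: contraTneq heavy_mass => ->.
  by rewrite big_set0 -leNgt subr_ge0.
have lower t : gam ^+ L <= law q (nseq L (1 : ('Z_a)^o)) t.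
  rewrite -[t](subrK (s0 *+ L)); apply: law_nseq_lower => //.
  by apply: genL; rewrite heavy_gen // inE.
have gam1 : gam ^+ L <= 1.
  exact: le_trans (lower 0) (law_le1 q_ge0 q_sum _ _).
move=> N; rewrite {1 2}(divn_eq N L); move: (N %/ L)%N (N %% L)%N => m j.
elim: m => [|m IHm] r r'.
  rewrite mul0n expr0 ler_norml.
  have := law_ge0 q_ge0 (nseq j (1 : ('Z_a)^o)).
  have := law_le1 q_ge0 q_sum (nseq j (1 : ('Z_a)^o)).
  move=> h1 h0; have := (h1 r, h1 r', h0 r, h0 r').
  by rewrite add0n; move=> [[[]]] *; apply/andP; split; lra.
rewrite mulSn -addnA nseqD !law_cat //.
set f := law q (nseq (_ * _ + _) _) in IHm *.
have sumf x : \sum_z f (x - z) = 1.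
  rewrite -(sum_law q_sum (nseq (m * L + j) (1 : ('Z_a)^o))) -/f.
  by rewrite [RHS](reindex_inj (inj_comp (addrI x) (@oppr_inj _))).
(* Doeblin minorization: the uniform part [gam ^+ L] of the law cancels in the
   difference. *)
have E x : \sum_z law q (nseq L (1 : ('Z_a)^o)) z * f (x - z) =
   \sum_z (law q (nseq L (1 : ('Z_a)^o)) z - gam ^+ L) * f (x - z) + gam ^+ L.
  rewrite -[X in _ + X]mulr1 -(sumf x) mulr_sumr -big_split /=.
  by apply: eq_bigr => z _; rewrite -mulrDl subrK.
rewrite !E opprD addrACA subrr addr0 -sumrB.
apply: (le_trans (ler_norm_sum _ _ _)).
apply: (@le_trans _ _ (\sum_z (law q (nseq L (1 : ('Z_a)^o)) z - gam ^+ L)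
                         * (1 - gam ^+ L) ^+ m)).
  apply: ler_sum => z _; rewrite -mulrBr normrM ger0_norm ?subr_ge0 //.
  by rewrite ler_wpM2l ?subr_ge0 // IHm.
rewrite -mulr_suml exprS ler_wpM2r ?exprn_ge0 ?subr_ge0 //.
(* The removed mass is gam^L at every residue; the part at 0 is enough for the bound. *)
rewrite sumrB sum_law // lerD2l lerN2 (bigD1 0) //= lerDl.
by apply: sumr_ge0 => z _; rewrite exprn_ge0 // ltW.
Qed.

End Mixing.

Lemma proper_subgroup_double (gT : finGroupType) (H K : {group gT}) :
  K \proper H -> (2 * #|K| <= #|H|)%N.
Proof.
case/andP=> sKH nHK.
by rewrite -(Lagrange sKH) mulnC leq_mul2l indexg_gt1 nHK orbT.
Qed.

Section Equidistribution.
Variables (R : realFieldType) (a : nat) (alpha : R) (q : 'Z_a -> R).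
Hypotheses (a_gt1 : (1 < a)%N) (alpha_le1 : alpha <= 1).
Hypothesis q_bal : balanced_weights alpha q.
Variable V : finLmodType 'Z_a.
Implicit Types (s t : seq V) (x y z : V) (K : {group V}).

Let q_ge0 r : 0 <= q r. Proof. by case: q_bal. Qed.
Let q_sum : \sum_r q r = 1. Proof. by case: q_bal. Qed.

(** Condition on all terms except one x outside K: the multiple of x has to lie in a prescribed
    coset of K, which determines its coefficient modulo some prime divisor of a. *)
Lemma law_coset_le K s y : has (fun x => x \notin K) s ->
  \sum_(z | y - z \in K) law q s z <= 1 - alpha.
Proof.
case/hasP=> x xs nKx.
under eq_bigr do rewrite (law_perm q (perm_to_rem xs)) /=.
rewrite big_mkcond /=.
have -> : \sum_z (if y - z \in K then
      \sum_r q r * law q (rem x s) (z - r *: x) else 0)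
  = \sum_u law q (rem x s) u * \sum_(r | y - u - r *: x \in K) q r.
  transitivity (\sum_z \sum_(r : 'Z_a)
     if y - z \in K then q r * law q (rem x s) (z - r *: x) else 0).
    by apply: eq_bigr => z _; case: ifP => // _; rewrite big1.
  rewrite exchange_big /=.
  under eq_bigr => r _ do rewrite (reindex_inj (addIr (r *: x))) /=.
  rewrite exchange_big /=; apply: eq_bigr => u _.
  rewrite [in RHS]big_mkcond mulr_sumr; apply: eq_bigr => r _.
  by rewrite addrK opprD addrA; case: ifP => _; rewrite ?mulr0 // mulrC.
rewrite -[leRHS]mul1r -[X in _ <= X * _](sum_law q_sum (rem x s)) mulr_suml.
apply: ler_sum => u _; rewrite ler_wpM2l ?law_ge0 //.
have [p /andP[p_pr p_a] sep] := prime_separation a_gt1 nKx.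
have [r0 Kr0|none] := pickP (fun r : 'Z_a => y - u - r *: x \in K); last first.
  by rewrite big1 ?subr_ge0 // => r; rewrite none.
have [_ _ /(_ p r0 p_pr p_a)] := q_bal; apply: le_trans.
rewrite [leLHS]big_mkcond [leRHS]big_mkcond; apply: ler_sum => r _.
case: ifP => [Kr|_]; last by case: ifP.
rewrite ifT //; apply/eqP/sep.
have -> : r *: x - r0 *: x = (y - u - r0 *: x) - (y - u - r *: x).
  by rewrite opprB [RHS]addrC subrKA.
exact: (groupM Kr0 (groupVr Kr)).
Qed.

Section Shift.
Variables (N L : nat) (e : R).
Hypothesis mix : forall r r',
  `|law q (nseq N (1 : ('Z_a)^o)) r - law q (nseq N (1 : ('Z_a)^o)) r'| <= e.
Hypothesis genL : forall (A : {set V}) x,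
  x \in <<A>>%g -> x \in ((1 |: A) ^+ L)%g.

Let e_ge0 : 0 <= e.
Proof. by rewrite (le_trans _ (mix 0 0)). Qed.

(** Through [law_nseq], adding x to the target shifts the scalar t by 1, so each of the a values of
    t contributes at most e. *)
Lemma law_shift s x y : (N <= count_mem x s)%N ->
  `|law q s (y + x) - law q s y| <= a%:R * e.
Proof.
move=> leN.
have [s' /(law_perm q) eq_s] : exists s', perm_eq s (nseq N x ++ s').
  exists (nseq (count_mem x s - N) x ++ [seq z <- s | z != x]).
  rewrite catA -nseqD subnKC // perm_sym -size_filter.
  by rewrite -(all_pred1P x _ (filter_all (pred1 x) s)) perm_filterC.
rewrite !eq_s !law_nseq (reindex_inj (addIr 1)) /= -sumrB.
apply: le_trans (ler_norm_sum _ _ _) _.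
have -> : a%:R * e = \sum_(t : 'Z_a) e.
  by rewrite sumr_const card_ord -[RHS]mulr_natl Zp_cast.
apply: ler_sum => t _.
rewrite scalerDl scale1r opprD addrACA subrr addr0 -mulrBl normrM.
by rewrite -[leRHS]mulr1 ler_pM ?normr_ge0 // ger0_norm ?law_ge0 ?law_le1.
Qed.

(** Going from z to y inside K takes L steps along entries that occur at least N times, each
    changing the law by at most a e. The law is thus nearly constant on K, where its total mass is
    1. *)
Lemma law_equidistributed K s y : {subset s <= K} ->
    K \subset <<[set x | (N <= count_mem x s)%N]>>%g -> y \in K ->
  `|law q s y - #|K|%:R^-1| <= L%:R * (a%:R * e).
Proof.
move=> sK genK Ky.
have K_gt0 : 0 < #|K|%:R :> R by rewrite ltr0n cardG_gt0.
have diff z : z \in K -> `|law q s y - law q s z| <= L%:R * (a%:R * e).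
  move=> Kz; have -> : y = z + (y - z) by rewrite addrC subrK.
  apply: (walk_bound (A := [set x | (N <= count_mem x s)%N])) => //.
  - by rewrite mulr_ge0 ?ler0n.
  - by move=> x u; rewrite inE => /law_shift.
  by apply/genL/(fintype.subsetP genK)/(groupM Ky (groupVr Kz)).
have sumK : \sum_(z in K) law q s z = 1.
  rewrite -(sum_law q_sum s) [RHS](bigID (mem K)) /= [X in _ + X]big1 ?addr0 //.
  by move=> z nKz; apply: law_supp nKz.
rewrite -(ler_pM2l K_gt0) -[X in X * `|_|]ger0_norm ?(ltW K_gt0) // -normrM mulrBr.
rewrite mulfV ?gt_eqF // -[X in _ - X]sumK.
have -> : #|K|%:R * law q s y = \sum_(z in K) law q s y.
  by rewrite sumr_const mulr_natl.
rewrite -sumrB (le_trans (ler_norm_sum _ _ _)) //.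
rewrite [leRHS]mulr_natl -sumr_const ler_sum // => z Kz; exact: diff.
Qed.

End Shift.

End Equidistribution.

(** * Subgroups containing most entries of a vector *)

Lemma count_notinI (T : Type) (P Q : pred T) s :
  count (fun x => ~~ (P x && Q x)) s
  = (count (fun x => ~~ P x) s + count (fun x => ~~ Q x) [seq x <- s | P x])%N.
Proof.
by elim: s => //= x s ->; case: (P x) => /=; [rewrite add0n addnCA | rewrite addnA].
Qed.

Lemma count_sum_count_mem (T : finType) (P : pred T) s :
  count P s = (\sum_(x | P x) count_mem x s)%N.
Proof.
elim: s => /= [|y s ->]; first by rewrite big1.
rewrite big_split /=; congr addn; rewrite big_mkcond (bigD1 y) //= eqxx.
rewrite big1 ?addn0; first by case: (P y).
by move=> x /negPf; rewrite eq_sym => ->; case: (P x).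
Qed.

Section Depth.
Variables (a : nat) (V : finLmodType 'Z_a) (D n : nat).
Implicit Types (s : seq V) (K H : {group V}).

(* The weight [#|K|] ensures that [s] equidistributes in a minimal such [K]:
   passing to a proper subgroup loses at least [n / (D #|K|)] further terms. *)
Definition nearly_inside s K := (count (fun x => x \notin K) s * #|K| * D <= n)%N.

Definition code_group H s : {group V} :=
  [arg min_(K < H | (K \subset H) && nearly_inside s K) #|K|].

Variant code_group_spec H s : {group V} -> Prop :=
  CodeGroupSpec K of K \subset H & nearly_inside s K &
    (forall K' : {group V}, K' \proper K -> ~~ nearly_inside s K') :
    code_group_spec H s K.

Lemma code_groupP H s : {subset s <= H} -> code_group_spec H s (code_group H s).
Proof.
move=> sH; rewrite /code_group; case: arg_minnP.
  rewrite subxx /nearly_inside (_ : count _ s = 0%N) //.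
  by apply/eqP; rewrite -leqn0 leqNgt -has_count; apply/hasPn => x /sH ->.
move=> K /andP[sKH nearK] minK; split=> // K' prK.
apply/negP => nearK'; have := minK K'; rewrite nearK' andbT.
move=> /(_ (fintype.subset_trans (proper_sub prK) sKH)).
by rewrite leqNgt proper_card.
Qed.

(** Otherwise let K' be the intersection of K with the group generated by the frequent entries. It
    misses at most #|V| N more entries than K, and #|K'| <= #|K| / 2, so its weighted count is at
    most half of n + N #|V|^2 D, hence at most n. This contradicts minimality. *)
Lemma code_generates s K N : (0 < D)%N -> (N * (#|V| ^ 2 * D) <= n)%N ->
    nearly_inside s K ->
    (forall K' : {group V}, K' \proper K -> ~~ nearly_inside s K') ->
  K \subset <<[set x | (N <= count_mem x [seq x <- s | x \in K])%N]>>%g.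
Proof.
move=> D_gt0 leN nearK minK; set S := [set x | _].
apply/idPn => nsub; pose K' : {group V} := (K :&: <<S>>)%G.
have prK : K' \proper K.
  rewrite properE subsetIl; apply: contra nsub => /fintype.subset_trans; apply.
  exact: subsetIr.
have := minK _ prK; rewrite /nearly_inside -ltnNge => ltn.
have countE : (count (fun x => x \notin K') s <=
    count (fun x => x \notin K) s + #|V| * N)%N.
  have -> : count (fun x => x \notin K') s = (count (fun x => x \notin K) s
      + count (fun x => x \notin <<S>>%g) [seq x <- s | x \in K])%N.
    rewrite -count_notinI; apply: eq_count => x /=; by rewrite inE.
  rewrite leq_add2l count_sum_count_mem -sum_nat_const big_mkcond /=.
  rewrite [leqRHS]big_mkcond /=; apply: leq_sum => x _; case: ifP => // nSx.
  rewrite ltnW // ltnNge; apply: contra nSx => leNx; apply: mem_gen.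
  by rewrite inE.
have double := proper_subgroup_double prK.
have leKV : (#|K| <= #|V|)%N by apply: max_card.
rewrite /nearly_inside in nearK; set w' := count _ s in ltn countE; set w := count _ s in countE nearK.
have h1 : (2 * (w' * #|K'| * D) <= w' * #|K| * D)%N.
  by rewrite mulnA leq_mul2r [(2 * _)%N]mulnCA leq_mul2l double !orbT.
have h2 : (w' * #|K| * D <= w * #|K| * D + N * (#|V| ^ 2 * D))%N.
  have -> : (N * (#|V| ^ 2 * D) = #|V| * N * #|V| * D)%N by ring.
  rewrite -mulnDl leq_mul2r (leq_trans (leq_mul countE (leqnn _))) ?orbT //.
  by rewrite mulnDl leq_add2l leq_mul2l leKV orbT.
clearbody w w'; by move: ltn h1 h2 leN nearK; lia.
Qed.

End Depth.

Section CodeBounds.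
Variables (R : realFieldType) (a : nat) (V : finLmodType 'Z_a).

(** The free parameter u prices the entries outside K: with u slightly below 1 and u^D small, the
    count is at most #|K|^n up to a small exponential factor. *)
Lemma card_nearly_inside (K : {group V}) (n D : nat) (u : R) :
    0 < u -> u <= 1 ->
  #|[set X : {ffun 'I_n -> V} | nearly_inside D n (codom X) K]|%:R * u ^+ n
    <= (#|K|%:R + u ^+ D * #|V|%:R) ^+ n.
Proof.
move=> u_gt0 u_le1.
(* Exponential Markov inequality for the number of entries outside [K]. *)
pose g x : R := if x \in K then 1 else u ^+ D.
have g_ge0 x : 0 <= g x by rewrite /g; case: ifP => // _; rewrite exprn_ge0 ?(ltW u_gt0).
apply: (@le_trans _ _ (\sum_(X : {ffun 'I_n -> V}) \prod_i g (X i))).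
  rewrite -sum1_card natr_sum mulr_suml big_mkcond; apply: ler_sum => X _.
  rewrite inE; case: ifP => [near|_]; last exact: prodr_ge0.
  have -> : \prod_i g (X i) = u ^+ (count (fun x => x \notin K) (codom X) * D).
    rewrite /codom /image_mem -(big_map X xpredT g) enumT.
    elim: map => [|x s IHs]; first by rewrite big_nil.
    rewrite big_cons IHs /= mulnDl exprD /g; case: (x \in K) => //=.
    by rewrite mul1n.
  rewrite mul1r ler_wiXn2l ?(ltW u_gt0) //; apply: leq_trans near.
  by rewrite leq_mul2r leq_pmulr ?orbT.
rewrite -(bigA_distr_bigA (fun _ => g)) prodr_const card_ord.
apply: lerXn2r; rewrite ?nnegrE ?sumr_ge0 ?addr_ge0 ?mulr_ge0 ?exprn_ge0 ?(ltW u_gt0) //.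
rewrite (bigID (mem K)) /= lerD //.
  by rewrite (eq_bigr (fun=> 1)) ?sumr_const // => x Kx; rewrite /g Kx.
rewrite (eq_bigr (fun=> u ^+ D)) => [|x /negPf nKx]; last by rewrite /g nKx.
rewrite sumr_const -[_ *+ _]mulr_natr ler_wpM2l ?exprn_ge0 ?(ltW u_gt0) //.
by rewrite ler_nat max_card.
Qed.

End CodeBounds.

(** * The moment estimate *)

Ltac nonneg := rewrite ?nnegrE; repeat first
  [ done | by apply: ltW | rewrite subr_ge0 | rewrite invr_ge0
  | apply: exprn_ge0 | apply: mulr_ge0 | apply: addr_ge0 ].

Lemma prod_near1 (R : realFieldType) (n : nat) (z : 'I_n -> R) (e : R) :
  (forall i, `|z i - 1| <= e) -> `|\prod_i z i - 1| <= (1 + e) ^+ n - 1.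
Proof.
elim: n z => [|n IHn] z ze; first by rewrite big_ord0 expr0 subrr normr0.
have e_ge0 : 0 <= e by apply: le_trans (ze ord0).
rewrite big_ord_recl exprS.
set p := \prod_i _; have /(IHn _) : forall i : 'I_n, `|z (lift ord0 i) - 1| <= e.
  by move=> i; apply: ze.
rewrite -/p => hp.
have -> : z ord0 * p - 1 = (z ord0 - 1) * (p - 1) + (z ord0 - 1) + (p - 1) by ring.
have -> : (1 + e) * (1 + e) ^+ n - 1 = e * ((1 + e) ^+ n - 1) + e + ((1 + e) ^+ n - 1) by ring.
do 2!(apply: le_trans (ler_normD _ _) _; rewrite lerD //).
by rewrite normrM ler_pM.
Qed.

Definition span (V : finZmodType) n (X : {ffun 'I_n -> V}) : {group V} :=
  <<[set X i | i : 'I_n]>>%G.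

Lemma mem_span (V : finZmodType) n (X : {ffun 'I_n -> V}) i : X i \in span X.
Proof. by apply: mem_gen; apply: imset_f. Qed.

Lemma span_sub (V : finZmodType) n (X : {ffun 'I_n -> V}) (H : {group V}) :
  (span X \subset H) = [forall i, X i \in H].
Proof.
rewrite gen_subG; apply/fintype.subsetP/forallP => [sXH i|XH x /imsetP[i _ ->] //].
by apply: sXH; apply: imset_f.
Qed.

Section CodeBounds.
Variables (R : realFieldType) (a : nat) (alpha : R) (q : 'Z_a -> R).
Hypotheses (a_gt1 : (1 < a)%N) (alpha_le : alpha <= 1 / 2).
Hypothesis q_bal : balanced_weights alpha q.
Variable V : finLmodType 'Z_a.
Variables (n D L : nat) (e : R).
Hypothesis D_gt0 : (0 < D)%N.
(** The largest number of repetitions that [code_generates] grants. *)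
Let N := (n %/ (#|V| ^ 2 * D))%N.
Hypothesis mix : forall r r',
  `|law q (nseq N (1 : ('Z_a)^o)) r - law q (nseq N (1 : ('Z_a)^o)) r'| <= e.
Hypothesis genL : forall (A : {set V}) x,
  x \in <<A>>%g -> x \in ((1 |: A) ^+ L)%g.
Implicit Types (H K : {group V}) (X : {ffun 'I_n -> V}).

Let q_ge0 r : 0 <= q r. Proof. by case: q_bal. Qed.
Let q_sum : \sum_r q r = 1. Proof. by case: q_bal. Qed.
Let alpha_le1 : alpha <= 1. Proof. by move: alpha_le; lra. Qed.
Let e_ge0 : 0 <= e. Proof. by rewrite (le_trans _ (mix 0 0)). Qed.
Let eps := L%:R * (a%:R * e).
Let eps_ge0 : 0 <= eps. Proof. by rewrite !mulr_ge0. Qed.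
Let v_gt0 : 0 < #|V|%:R :> R.
Proof. by rewrite ltr0n; apply/card_gt0P; exists 0. Qed.

Let minimal_code X K := nearly_inside D n (codom X) K /\
  (forall K' : {group V}, K' \proper K -> ~~ nearly_inside D n (codom X) K').

Lemma law_code_inside X K y : minimal_code X K -> y \in K ->
  `|law q [seq x <- codom X | x \in K] y - #|K|%:R^-1| <= eps.
Proof.
case=> nearK minK Ky; apply: (law_equidistributed a_gt1 q_bal mix genL) => //.
  by move=> x; rewrite mem_filter => /andP[].
exact: (code_generates D_gt0 (leq_trunc_div _ _) nearK minK).
Qed.

(** Split the entries of X. Those outside K must bring the sum into a given coset of K, at a cost 1
    - alpha if there are any; those in K must then hit one element, with probability close to 1 /
    #|K|. *)
Lemma law_code_le X K y : K \subset span X -> minimal_code X K ->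
  law q (codom X) y <= (#|K|%:R^-1 + eps) * (if K == span X then 1 else 1 - alpha).
Proof.
move=> sK codeK.
have f_ge0 : 0 <= #|K|%:R^-1 + eps by rewrite addr_ge0 ?invr_ge0.
set t := [seq x <- codom X | x \notin K].
have /(law_perm q) -> : perm_eq (codom X) (t ++ [seq x <- codom X | x \in K]).
  by rewrite perm_sym perm_catC perm_filterC.
rewrite law_cat; apply: (@le_trans _ _
  (\sum_(z | y - z \in K) law q t z * (#|K|%:R^-1 + eps))).
  rewrite [leRHS]big_mkcond /=; apply: ler_sum => z _; case: ifPn => Kz.
    rewrite ler_wpM2l ?law_ge0 // -lerBlDl.
    by apply: le_trans (ler_norm _) (law_code_inside codeK Kz).
  rewrite [X in _ * X](_ : _ = 0) ?mulr0 //; apply: law_supp Kz => x.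
  by rewrite mem_filter => /andP[].
rewrite -mulr_suml mulrC ler_wpM2l //; case: eqP => [_|neqK].
  rewrite -(sum_law q_sum t) [leRHS](bigID (fun z => y - z \in K)) /= lerDl.
  by apply: sumr_ge0 => z _; apply: law_ge0.
apply: (law_coset_le a_gt1 alpha_le1 q_bal).
rewrite has_filter -filter_predI (eq_filter (a2 := fun x => x \notin K)).
  rewrite -has_filter; apply/idPn => /hasPn allK; case: neqK.
  apply/val_inj/eqP; rewrite finset.eqEsubset sK span_sub; apply/forallP => i.
  by rewrite -[_ \in _]negbK; apply: allK; apply: codom_f.
by move=> x /=; rewrite andbb.
Qed.

(** Here u = 1 / (1 + eta). One factor 1 + eta pays for u^n, the other for the term u^D #|V| <=
    eta. *)
Lemma card_nearly_inside_le K (eta : R) : 0 < eta ->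
    (1 + eta)^-1 ^+ D * #|V|%:R <= eta ->
  #|[set X : {ffun 'I_n -> V} | nearly_inside D n (codom X) K]|%:R
    <= (#|K|%:R * (1 + eta) ^+ 2) ^+ n.
Proof.
move=> eta_gt0 eta_D; have eta1_gt0 : 0 < 1 + eta by rewrite addr_gt0.
have u_gt0 : 0 < (1 + eta)^-1 by rewrite invr_gt0.
have := card_nearly_inside K n D u_gt0; rewrite invf_le1 // lerDl (ltW eta_gt0).
rewrite exprVn ler_pdivrMr ?exprn_gt0 // => /(_ isT)/le_trans; apply.
rewrite -exprMn; have K_ge1 : 1 <= #|K|%:R :> R by rewrite ler1n cardG_gt0.
apply: lerXn2r; [by nonneg | by nonneg | ].
rewrite expr2 mulrA ler_wpM2r ?(ltW eta1_gt0) // mulrDr mulr1 lerD2l.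
by apply: le_trans eta_D _; rewrite ler_peMl // ltW.
Qed.

(** The three terms are the equidistribution error over the set C of vectors whose attached subgroup
    is all of H, the proportion of vectors over H outside C, and the mass of the remaining
    generating vectors. In the last one the counting bound (#|K| (1 + eta)^2)^n meets the
    probability ((#|K|^(-1) + eps) (1 - alpha))^n. *)
Lemma moment_bound H (Y : 'I_n -> V) (eta : R) : 0 < eta ->
    (1 + eta)^-1 ^+ D * #|V|%:R <= eta ->
    (forall c, Y c \in H) ->
  `|\sum_(X : {ffun 'I_n -> V} | span X == H) \prod_c law q (codom X) (Y c) - 1|
   <= ((1 + #|V|%:R * eps) ^+ n - 1)
      + #|{group V}|%:R * ((1 - alpha) * (1 + eta) ^+ 2) ^+ n
      + #|{group V}|%:R * ((1 - alpha) * (1 + eta) ^+ 2) ^+ n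
        * (1 + #|V|%:R * eps) ^+ n.
Proof.
move=> eta_gt0 eta_D HY; set th := (1 - alpha) * _.
pose p X := \prod_c law q (codom X) (Y c).
have p_ge0 X : 0 <= p X by apply: prodr_ge0 => c _; apply: law_ge0.
pose near K := [set X : {ffun 'I_n -> V} | nearly_inside D n (codom X) K].
pose C := [set X : {ffun 'I_n -> V} | (span X == H) && (code_group D n H (codom X) == H)].
have spanP X : span X = H -> {subset codom X <= H}.
  by move=> <- _ /codomP[i ->]; apply: mem_span.
have H_gt0 : 0 < #|H|%:R :> R by rewrite ltr0n cardG_gt0.
have leHV : #|H|%:R <= #|V|%:R :> R by rewrite ler_nat max_card.
have eta1_gt0 : 0 < 1 + eta by rewrite addr_gt0.
have th_ge0 : 0 <= th.
  by rewrite /th; nonneg.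
have codeP X : X \in C -> forall y, y \in H ->
    `|law q (codom X) y - #|H|%:R^-1| <= eps.
  rewrite inE => /andP[/eqP sX /eqP cX] y Hy.
  move: cX; case: code_groupP => [|K _ nearK minK eqK]; first exact: spanP.
  rewrite eqK in nearK minK.
  have := law_code_inside (conj nearK minK) Hy.
  suff -> : [seq x <- codom X | x \in H] = codom X by [].
  by apply/all_filterP/allP/spanP.
have cardE (A : {set {ffun 'I_n -> V}}) : \sum_X (X \in A)%:R = #|A|%:R :> R.
  by rewrite -sum1_card natr_sum [RHS]big_mkcond; apply: eq_bigr => X _; case: ifP.
pose HN : {set {ffun 'I_n -> V}} := [set X in ffun_on H].
have cardHN : #|HN|%:R = #|H|%:R ^+ n :> R.
  by rewrite cardsE card_ffun_on card_ord natrX.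
have geC : #|C|%:R / #|H|%:R ^+ n <= 1 :> R.
  rewrite ler_pdivrMr ?exprn_gt0 // mul1r -cardHN ler_nat subset_leq_card //.
  apply/fintype.subsetP => X; rewrite !inE => /andP[/eqP sX _].
  by apply/ffun_onP => i; rewrite -sX mem_span.
have code_bound :
    `|\sum_(X in C) p X - #|C|%:R / #|H|%:R ^+ n| <= (1 + #|V|%:R * eps) ^+ n - 1.
  have -> : \sum_(X in C) p X - #|C|%:R / #|H|%:R ^+ n =
      (\sum_(X in C) (\prod_c (#|H|%:R * law q (codom X) (Y c)) - 1)) / #|H|%:R ^+ n.
    rewrite sumrB sumr_const mulrBl mulr_suml; congr (_ - _).
    apply: eq_bigr => X _; rewrite big_split /= prodr_const card_ord -/(p X).
    by rewrite mulrAC mulfV ?mul1r // expf_neq0 // gt_eqF.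
  have hn0 : 0 <= #|H|%:R ^+ n :> R by rewrite exprn_ge0 // ltW.
  rewrite normrM normfV (ger0_norm hn0).
  have b_ge0 : 0 <= (1 + #|V|%:R * eps) ^+ n - 1.
    by rewrite subr_ge0 exprn_ege1 // lerDl mulr_ge0.
  rewrite -[leRHS]mulr1; apply: le_trans (ler_wpM2l b_ge0 geC).
  rewrite mulrA ler_wpM2r ?invr_ge0 // (le_trans (ler_norm_sum _ _ _)) //.
  rewrite [leRHS]mulr_natr -[leRHS]sumr_const ler_sum // => X CX.
  apply: le_trans (@prod_near1 _ _ _ (#|H|%:R * eps) _) _.
    move=> c; rewrite -[X in _ - X](mulfV (lt0r_neq0 H_gt0)) -mulrBr normrM.
    by rewrite ger0_norm ?(ltW H_gt0) // ler_wpM2l ?(ltW H_gt0) // codeP.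
  rewrite lerD2r; apply: lerXn2r; [by nonneg | by nonneg | ].
  by rewrite lerD2l ler_wpM2r.
have leC : 1 - #|C|%:R / #|H|%:R ^+ n <= #|{group V}|%:R * th ^+ n.
  (* A vector over H outside C lies nearly inside a proper subgroup: its span if that is proper,
     otherwise its attached subgroup. *)
  have le1 : #|HN|%:R <= #|C|%:R + \sum_(K : {group V} | K \proper H) #|near K|%:R :> R.
    under eq_bigr do rewrite -cardE.
    rewrite -!cardE exchange_big -big_split /=; apply: ler_sum => X _.
    have sum_ge0 (P : pred {group V}) : 0 <= \sum_(K | P K) (X \in near K)%:R :> R.
      exact: sumr_ge0.
    have [CX|nCX] := boolP (X \in C); first by rewrite ler_wpDr // ler_nat; case: (_ \in HN).
    rewrite add0r; case: (boolP (X \in HN)) => // HNX.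
    suff [K prK nearK] : exists2 K : {group V}, K \proper H & X \in near K.
      by rewrite (bigD1 K) //= nearK lerDl.
    move: HNX; rewrite inE => /ffun_onP XH.
    have sXH : span X \subset H by rewrite span_sub; apply/forallP.
    have [eqs|neqs] := eqVneq (span X) H; last first.
      exists (span X).
        by rewrite finset.properEneq sXH andbT; apply: contra neqs => /eqP/val_inj->.
      rewrite inE /nearly_inside (_ : count _ _ = 0%N) //.
      by apply/eqP; rewrite -leqn0 leqNgt -has_count; apply/hasPn => _ /codomP[i ->]; rewrite mem_span.
    move: nCX; rewrite inE eqs eqxx /=; case: code_groupP => [|K sKH nearK _ neqK].
      exact: spanP.
    exists K; last by rewrite inE.
    by rewrite finset.properEneq sKH andbT; apply: contra neqK => /eqP/val_inj->.
  rewrite -(ler_pM2r (exprn_gt0 n H_gt0)) mulrBl mul1r divfK ?expf_neq0 ?gt_eqF //.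
  rewrite -cardHN lerBlDl (le_trans le1) // lerD2l cardHN.
  apply: (@le_trans _ _ (\sum_(K : {group V}) (th * #|H|%:R) ^+ n)); last first.
    by rewrite sumr_const -[leLHS]mulr_natl exprMn mulrA.
  rewrite big_mkcond ler_sum // => K _; case: ifP => [prK|_]; last first.
    by rewrite exprn_ge0 // mulr_ge0.
  apply: le_trans (card_nearly_inside_le K eta_gt0 eta_D) _.
  apply: lerXn2r; [by nonneg | by nonneg | ].
  rewrite /th mulrAC ler_wpM2r ?exprn_ge0 ?(ltW eta1_gt0) //.
  have := proper_subgroup_double prK; rewrite -(ler_nat R) natrM => le2.
  (* K has index at least 2 in H, and 1 / 2 <= 1 - alpha lets both errors decay at the same rate
     [th]. *)
  have : (1 - alpha) * #|H|%:R >= 1 / 2 * #|H|%:R.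
    by rewrite ler_wpM2r ?(ltW H_gt0) //; move: alpha_le; lra.
  by move: le2; lra.
have noncode_bound : \sum_(X | (span X == H) && (X \notin C)) p X
   <= #|{group V}|%:R * th ^+ n * (1 + #|V|%:R * eps) ^+ n.
  pose B (K : {group V}) := (#|K|%:R^-1 + eps) * (1 - alpha).
  have B_ge0 K : 0 <= B K by rewrite /B; nonneg.
  apply: (@le_trans _ _ (\sum_(K : {group V}) #|near K|%:R * B K ^+ n)).
    under [leRHS]eq_bigr do rewrite -cardE mulr_suml.
    rewrite exchange_big big_mkcond /=; apply: ler_sum => X _.
    have sum_ge0 (P : pred {group V}) :
      0 <= \sum_(K | P K) (X \in near K)%:R * B K ^+ n.
      by apply: sumr_ge0 => K _; rewrite mulr_ge0 ?exprn_ge0.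
    case: ifP => // /andP[/eqP sX]; rewrite inE sX eqxx /=.
    case: code_groupP => [|K sKH nearK minK neqK]; first exact: spanP.
    rewrite (bigD1 K) //=; apply: ler_wpDr; first exact: sum_ge0.
    have -> : X \in near K by rewrite inE.
    rewrite mul1r.
    have -> : B K ^+ n = \prod_(c < n) B K by rewrite prodr_const card_ord.
    apply: ler_prod => c _; rewrite law_ge0 //=.
    have := @law_code_le X K (Y c); rewrite sX (negPf neqK); apply => //.
  rewrite -mulrA -exprMn [leRHS]mulr_natl -[leRHS]sumr_const ler_sum // => K _.
  apply: le_trans (ler_wpM2r (exprn_ge0 _ (B_ge0 K))
    (card_nearly_inside_le K eta_gt0 eta_D)) _.
  have K_gt0 : 0 < #|K|%:R :> R by rewrite ltr0n cardG_gt0.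
  rewrite -exprMn; apply: lerXn2r; [by nonneg | by nonneg | ].
  have -> : #|K|%:R * (1 + eta) ^+ 2 * B K = th * (1 + #|K|%:R * eps).
    by rewrite /B /th; field; rewrite gt_eqF.
  by rewrite ler_wpM2l // lerD2l ler_wpM2r // ler_nat max_card.
have noncode_ge0 : 0 <= \sum_(X | (span X == H) && (X \notin C)) p X.
  exact: sumr_ge0.
have -> : \sum_(X | span X == H) p X
    = \sum_(X in C) p X + \sum_(X | (span X == H) && (X \notin C)) p X.
  rewrite (bigID (mem C)) /=; congr (_ + _); apply: eq_bigl => X.
  by rewrite inE; case: (span X == H).
move: code_bound; rewrite !ler_norml => /andP[h1 h2].
by apply/andP; split; lra.
Qed.

End CodeBounds.

(** * Elementary inequalities and the choice of constants *)

Lemma bernoulli_le (R : realFieldType) (x : R) n :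
  -1 <= x -> 1 + n%:R * x <= (1 + x) ^+ n.
Proof.
move=> x_ge; elim: n => [|n IHn]; first by rewrite mul0r addr0 expr0.
rewrite exprS; apply: le_trans (ler_wpM2l _ IHn); last by lra.
have -> : (1 + x) * (1 + n%:R * x) = 1 + n.+1%:R * x + n%:R * x ^+ 2.
  by rewrite -addn1 natrD; ring.
by rewrite lerDl mulr_ge0 ?sqr_ge0.
Qed.

(** Bernoulli applied to 1 / t. It absorbs the factor n that arises when the errors of n coordinates
    accumulate. *)
Lemma geometric_linear (R : realFieldType) (t : R) n : 0 < t -> t < 1 ->
  n%:R * t ^+ n <= t / (1 - t).
Proof.
move=> t_gt0 t_lt1.
have h1 : 0 < 1 - t by rewrite subr_gt0.
rewrite -ler_pdivlMr ?exprn_gt0 // -exprVn.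
have -> : t^-1 = 1 + (1 - t) / t by field; rewrite gt_eqF.
have := @bernoulli_le R ((1 - t) / t) n.
have : 0 <= (1 - t) / t by rewrite divr_ge0 // ltW.
set y := (1 - t) / t => y_ge0 /(_ _)/wrap[]; first by lra.
move=> h; apply: (@le_trans _ _ (t / (1 - t) * (1 + n%:R * y))); last first.
  by rewrite ler_wpM2l // divr_ge0 // ltW.
have -> : t / (1 - t) * (1 + n%:R * y) = t / (1 - t) + n%:R.
  by rewrite /y; field; rewrite !gt_eqF.
by rewrite lerDr divr_ge0 // ltW.
Qed.

Lemma expr1D_sub1_le (R : realFieldType) (x : R) n :
  0 <= x -> (1 + x) ^+ n - 1 <= n%:R * x * (1 + x) ^+ n.
Proof.
move=> x_ge0; elim: n => [|n IHn]; first by rewrite subrr !mul0r.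
rewrite exprS; set p := (1 + x) ^+ n in IHn *.
have -> : (1 + x) * p - 1 = (1 + x) * (p - 1) + x by ring.
have p_ge1 : 1 <= p by rewrite exprn_ege1 // lerDl.
apply: (@le_trans _ _ ((1 + x) * (n%:R * x * p) + x * ((1 + x) * p))).
  rewrite lerD ?ler_wpM2l ?addr_ge0 //.
  by rewrite ler_peMr // mulr_ege1 // lerDl.
by rewrite -addn1 natrD le_eqVlt; apply/orP; left; apply/eqP; ring.
Qed.

(** Bernoulli gives 1 - b <= t^(2m), and the factor t^(-2m) pays for the rounding in n / m. The
    square leaves a spare t^n to absorb a factor n. *)
Lemma expr_divn_le (R : realFieldType) (b t : R) (m n : nat) :
    0 < b -> b <= 1 -> (0 < m)%N -> t = 1 - b / (2 * m%:R) ->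
  (1 - b) ^+ (n %/ m) <= t ^- (2 * m) * (t ^+ n) ^+ 2.
Proof.
move=> b_gt0 b_le1 m_gt0 tE.
have m_gt0' : 0 < m%:R :> R by rewrite ltr0n.
have m2_ge1 : 2 <= 2 * m%:R :> R by rewrite ler_peMr // ler1n.
have t_gt0 : 0 < t.
  by rewrite tE subr_gt0 ltr_pdivrMr ?mulr_gt0 // mul1r; lra.
have t_le1 : t <= 1 by rewrite tE gerBl divr_ge0 // ltW // mulr_gt0.
have le_b : 1 - b <= t ^+ (2 * m).
  have := @bernoulli_le R (- (b / (2 * m%:R))) (2 * m).
  have -> : 1 + (2 * m)%:R * - (b / (2 * m%:R)) = 1 - b.
    by rewrite natrM; field; rewrite gt_eqF.
  by rewrite tE; apply; move: t_gt0; rewrite tE; lra.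
rewrite mulrC ler_pdivlMr ?exprn_gt0 //.
apply: (@le_trans _ _ ((t ^+ (2 * m)) ^+ (n %/ m) * t ^+ (2 * m))).
  by rewrite ler_wpM2r ?exprn_ge0 ?(ltW t_gt0) // lerXn2r ?nnegrE ?exprn_ge0 ?(ltW t_gt0) ?subr_ge0.
rewrite -!exprM -exprD ler_wiXn2l ?(ltW t_gt0) //.
have := ltn_ceil n m_gt0; move: (n %/ m)%N => k; nia.
Qed.

Lemma moment_limit (R : realType) (a : nat) (alpha : R) (V : finLmodType 'Z_a) :
    (1 < a)%N -> 0 < alpha -> alpha <= 1 / 2 ->
  exists C th : R, [/\ 0 <= C, 0 < th, th < 1 &
    forall (q : 'Z_a -> R), balanced_weights alpha q ->
    forall (n : nat) (H : {group V}) (Y : 'I_n -> V), (forall c, Y c \in H) ->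
    `|\sum_(X : {ffun 'I_n -> V} | span X == H) \prod_c law q (codom X) (Y c) - 1|
      <= C * th ^+ n].
Proof.
move=> a_gt1 alpha_gt0 alpha_le.
pose v : R := #|V|%:R.
have V_gt0 : (0 < #|V|)%N by apply/card_gt0P; exists 0.
(* With this value (1 - alpha) (1 + eta)^2 is at most 1 - alpha / 2. *)
pose eta : R := alpha / 4.
have eta_gt0 : 0 < eta by rewrite divr_gt0.
have [D D_gt0 eta_D] : exists2 D, (0 < D)%N & (1 + eta)^-1 ^+ D * v <= eta.
  (* By Bernoulli (1 + eta)^D is at least D eta, which has to reach #|V| / eta. *)
  exists (Num.Def.trunc (v / eta / eta)).+1 => //.
  have p_gt0 : 0 < (1 + eta) ^+ (Num.Def.trunc (v / eta / eta)).+1.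
    by rewrite exprn_gt0 // addr_gt0.
  rewrite exprVn mulrC ler_pdivrMr // mulrC -ler_pdivrMr //.
  apply: le_trans (bernoulli_le _ _); last by lra.
  rewrite ler_wpDl // -ler_pdivrMr //.
  by apply: ltW; apply: truncnS_gt.
have [L1 L1_gt0 gen1] := bounded_generation ('Z_a)^o.
have [L L_gt0 genL] := bounded_generation V.
pose b : R := (alpha / (2 * a%:R)) ^+ L1.
have a_gt1' : 1 < a%:R :> R by rewrite ltr1n.
have gam_gt0 : 0 < alpha / (2 * a%:R) by rewrite divr_gt0 // mulr_gt0 // (lt_trans _ a_gt1').
have b_gt0 : 0 < b by rewrite exprn_gt0.
have b_le1 : b <= 1.
  rewrite exprn_ile1 ?(ltW gam_gt0) // ler_pdivrMr ?mul1r; last by lra.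
  by lra.
(* A block of L1 summands contracts by 1 - b, and each generator is repeated n / (#|V|^2 D) times,
   which makes n / m blocks. *)
pose m := (#|V| ^ 2 * D * L1)%N.
have m_gt0 : (0 < m)%N by rewrite /m !muln_gt0 ?V_gt0 ?D_gt0 ?L1_gt0.
pose t : R := 1 - b / (2 * m%:R).
have m_ge1 : 1 <= m%:R :> R by rewrite ler1n.
have t_gt0 : 0 < t.
  by rewrite subr_gt0 ltr_pdivrMr ?mul1r; lra.
have t_lt1 : t < 1 by rewrite gtrBl divr_gt0 //; lra.
pose B : R := v * L%:R * a%:R * t ^- (2 * m).
have B_ge0 : 0 <= B by rewrite !mulr_ge0 ?invr_ge0 ?exprn_ge0 // ltW.
pose C1 : R := t / (1 - t).
have C1_ge0 : 0 <= C1 by apply: divr_ge0; [exact: ltW | rewrite subr_ge0; exact: ltW].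
(* Bounds (1 + x)^n, where x is the relative error of one coordinate, because n x <= B C1. *)
pose E : R := expR (B * C1).
pose th2 : R := (1 - alpha) * (1 + eta) ^+ 2.
have th2_ge0 : 0 <= th2 by rewrite mulr_ge0 ?sqr_ge0 // subr_ge0; lra.
have th2_lt1 : th2 < 1.
  have -> : th2 = 1 - alpha / 2 - alpha ^+ 2 * (7 / 16 + alpha / 16).
    by rewrite /th2 /eta; field.
  have : 0 <= alpha ^+ 2 * (7 / 16 + alpha / 16).
    by rewrite mulr_ge0 ?sqr_ge0 //; lra.
  by lra.
pose G : R := #|{group V}|%:R.
pose th := Num.max t th2.
have E_ge0 : 0 <= E by apply: expR_ge0.
have G_ge0 : 0 <= G by apply: ler0n.
exists (B * C1 * E + G + G * E), th; split.
- by nonneg.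
- by rewrite /th lt_max t_gt0.
- by rewrite /th gt_max t_lt1 th2_lt1.
move=> q q_bal n H Y HY.
have alpha_le1 : alpha <= 1 by lra.
have mix := law_nseq_contract a_gt1 alpha_gt0 alpha_le1 q_bal L1_gt0 gen1.
have := moment_bound a_gt1 alpha_le q_bal D_gt0 (mix _) (genL) eta_gt0 eta_D HY.
move/le_trans; apply.
rewrite -divnMA -/m -/b -/v -/th2 -/G.
set x := v * _.
have x_le : x <= B * (t ^+ n) ^+ 2.
  rewrite /x /B -!mulrA; do 3!rewrite ler_wpM2l //.
  exact: expr_divn_le.
have x_ge0 : 0 <= x.
  by rewrite /x !mulr_ge0 // exprn_ge0 // subr_ge0.
have nx_le : n%:R * x <= B * C1 * t ^+ n.
  apply: (@le_trans _ _ (n%:R * (B * (t ^+ n) ^+ 2))); first by rewrite ler_wpM2l.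
  have -> : n%:R * (B * (t ^+ n) ^+ 2) = B * (n%:R * t ^+ n) * t ^+ n by ring.
  rewrite ler_wpM2r ?exprn_ge0 ?(ltW t_gt0) // ler_wpM2l //.
  exact: geometric_linear.
have le_E : (1 + x) ^+ n <= E.
  apply: (@le_trans _ _ (expR x ^+ n)).
    by rewrite lerXn2r ?nnegrE ?addr_ge0 ?expR_ge0 // expR_ge1Dx.
  rewrite -expRM_natl ler_expR (le_trans nx_le) //.
  by rewrite ler_piMr ?(mulr_ge0 B_ge0 C1_ge0) // exprn_ile1 ?(ltW t_gt0) ?(ltW t_lt1).
have tn : t ^+ n <= th ^+ n.
  by apply: lerXn2r; rewrite ?nnegrE /th ?le_max ?lexx ?(ltW t_gt0).
have th2n : th2 ^+ n <= th ^+ n.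
  by apply: lerXn2r; rewrite ?nnegrE /th ?le_max ?lexx ?th2_ge0 ?orbT.
rewrite [leRHS]mulrDl [in leRHS]mulrDl; apply: lerD; first apply: lerD.
- apply: le_trans (expr1D_sub1_le _ x_ge0) _.
  apply: (@le_trans _ _ (B * C1 * t ^+ n * E)).
    by apply: ler_pM => //; nonneg.
  by rewrite mulrAC ler_wpM2l //; nonneg.
- by rewrite ler_wpM2l.
- by rewrite [leRHS]mulrAC; apply: ler_pM => //; [nonneg | nonneg | rewrite ler_wpM2l].
Qed.

(** * Matrices acting on vectors of module elements *)

Definition fcons (U : Type) n (u : U) (g : {ffun 'I_n -> U}) : {ffun 'I_n.+1 -> U} :=
  [ffun i => if unlift ord0 i is Some j then g j else u].

Lemma fcons0 (U : Type) n (u : U) (g : {ffun 'I_n -> U}) : fcons u g ord0 = u.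
Proof. by rewrite ffunE unlift_none. Qed.

Lemma fconsS (U : Type) n (u : U) (g : {ffun 'I_n -> U}) i :
  fcons u g (lift ord0 i) = g i.
Proof. by rewrite ffunE liftK. Qed.

Lemma codom_ordS (U : Type) n (f : 'I_n.+1 -> U) :
  codom f = f ord0 :: codom (fun i => f (lift ord0 i)).
Proof. by rewrite /codom /image_mem enum_ordSl /= -map_comp. Qed.

Lemma codom_fcons (U : Type) n (u : U) (g : {ffun 'I_n -> U}) :
  codom (fcons u g) = u :: codom g.
Proof.
by rewrite codom_ordS fcons0; congr cons; apply: eq_codom => i; rewrite fconsS.
Qed.

Lemma big_fcons (R : nmodType) (U : finType) n (F : {ffun 'I_n.+1 -> U} -> R) :
  \sum_X F X = \sum_u \sum_(g : {ffun 'I_n -> U}) F (fcons u g).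
Proof.
rewrite pair_big /= (reindex (fun ug : U * {ffun 'I_n -> U} => fcons ug.1 ug.2)) //.
exists (fun X : {ffun 'I_n.+1 -> U} => (X ord0, [ffun i : 'I_n => X (lift ord0 i)])) => [[u g]|X] _ /=.
  by rewrite fcons0; congr pair; apply/ffunP => i; rewrite ffunE fconsS.
apply/ffunP => i; case: (unliftP ord0 i) => [j|] ->; first by rewrite fconsS ffunE.
by rewrite fcons0.
Qed.

Section MatrixAction.
Variables (a n : nat) (V : finLmodType 'Z_a).
Implicit Types (A B : 'M['Z_a]_n) (X : {ffun 'I_n -> V}).

(* [X] is a column vector over the module [V], that is, a homomorphism R^n -> V
   given by the images of the basis vectors. *)
Definition mxact A X : {ffun 'I_n -> V} := [ffun c => \sum_r A c r *: X r].

Lemma mxact1 X : mxact 1%:M X = X.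
Proof.
apply/ffunP => c; rewrite ffunE (bigD1 c) //= mxE eqxx scale1r big1 ?addr0 //.
by move=> r /negPf; rewrite mxE eq_sym => ->; rewrite scale0r.
Qed.

Lemma mxactM A B X : mxact (A *m B) X = mxact A (mxact B X).
Proof.
apply/ffunP => c; rewrite !ffunE.
under eq_bigr do rewrite mxE scaler_suml.
rewrite exchange_big; apply: eq_bigr => r _.
by rewrite ffunE scaler_sumr; apply: eq_bigr => s _; rewrite scalerA.
Qed.

Lemma mxact0 A : mxact A [ffun=> 0] = [ffun=> 0].
Proof. by apply/ffunP => c; rewrite !ffunE big1 // => r _; rewrite ffunE scaler0. Qed.

Lemma scale_group (H : {group V}) (r : 'Z_a) (x : V) : x \in H -> r *: x \in H.
Proof. by move=> Hx; rewrite -[r]natr_Zp scaler_nat; apply: groupX. Qed.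

Lemma sum_group (I : Type) (s : seq I) (P : pred I) (H : {group V}) (F : I -> V) :
  (forall i, P i -> F i \in H) -> \sum_(i <- s | P i) F i \in H.
Proof. by move=> HF; apply: (big_ind (fun x => x \in H)) => //; [exact: (group1 H) | exact: (@groupM _ H)]. Qed.

Lemma mxact_span A X c : mxact A X c \in span X.
Proof.
by rewrite ffunE; apply: sum_group => r _; apply/scale_group/mem_span.
Qed.

Lemma span_mxact_unit A X : A \in unitmx -> span (mxact A X) = span X.
Proof.
move=> uA; apply/val_inj/eqP; rewrite finset.eqEsubset !span_sub.
apply/andP; split; apply/forallP => c; first exact: mxact_span.
by rewrite -{1}[X]mxact1 -(mulVmx uA) mxactM; apply: mxact_span.
Qed.

Section Weights.
Variables (R : realFieldType) (q : 'Z_a -> R).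

Definition mxweight A : R := \prod_c \prod_r q (A c r).

End Weights.
End MatrixAction.

Section LawMatrix.
Variables (a : nat) (V : finLmodType 'Z_a) (R : realFieldType) (q : 'Z_a -> R).

Lemma law_codom n (X : {ffun 'I_n -> V}) y : law q (codom X) y
  = \sum_(m : {ffun 'I_n -> 'Z_a}) (\prod_r q (m r)) * (\sum_r m r *: X r == y)%:R.
Proof.
elim: n X y => [|n IHn] X y.
  have -> : codom X = [::] by apply: size0nil; rewrite size_codom card_ord.
  rewrite (bigD1 [ffun=> 0]) //= big_ord0 mul1r big_ord0 eq_sym big1 ?addr0 //.
  by move=> m /eqP[]; apply/ffunP => -[].
rewrite codom_ordS /= big_fcons; apply: eq_bigr => r _.
have -> : codom (fun i => X (lift ord0 i)) = codom [ffun i => X (lift ord0 i)].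
  by apply: eq_codom => i; rewrite ffunE.
rewrite IHn mulr_sumr; apply: eq_bigr => m _.
rewrite !big_ord_recl !fcons0 mulrA; congr (_ * _ * _%:R).
  by apply: eq_bigr => i _; rewrite fconsS.
rewrite -(inj_eq (addrI (r *: X ord0))) [_ + (y - _)]addrC subrK.
by congr (_ + _ == _); apply: eq_bigr => i _; rewrite fconsS ffunE.
Qed.

(** Row c of A alone decides entry c of the image of X, and distinct rows are independent. *)
Lemma sum_mxweight n (X Y : {ffun 'I_n -> V}) :
  \sum_(A : 'M['Z_a]_n) mxweight q A * (mxact A X == Y)%:R
  = \prod_c law q (codom X) (Y c).
Proof.
under eq_bigr do rewrite law_codom.
rewrite bigA_distr_bigA /=.
rewrite (reindex (fun g : {ffun 'I_n -> {ffun 'I_n -> 'Z_a}} => \matrix_(c, r) g c r)) /=.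
  apply: eq_bigr => g _; rewrite big_split /=; congr (_ * _).
    by apply: eq_bigr => c _; apply: eq_bigr => r _; rewrite mxE.
  have -> : (mxact (\matrix_(c, r) g c r) X == Y)
      = [forall c, \sum_r g c r *: X r == Y c].
    apply/eqP/forallP => [<- c|eqY].
      by rewrite ffunE; apply/eqP/eq_bigr => r _; rewrite mxE.
    by apply/ffunP => c; rewrite -(eqP (eqY c)) ffunE; apply: eq_bigr => r _; rewrite mxE.
  case: forallP => [all_eq|/forallP/forallPn[c /negPf nc]].
    by rewrite big1 // => c _; rewrite all_eq.
  by rewrite [RHS](bigD1 c) //= nc mul0r.
exists (fun A : 'M['Z_a]_n => [ffun c => [ffun r => A c r]]) => [g|A] _.
  by apply/ffunP => c; apply/ffunP => r; rewrite !ffunE mxE.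
by apply/matrixP => c r; rewrite mxE !ffunE.
Qed.

End LawMatrix.

(** * Paths with nearly stochastic transition weights *)

Section ChainSum.
Variables (R : realFieldType) (U : finType).

(** The factor at i involves X_i and its predecessor, read off by [nth]: y0 when i = 0. Summing over
    the tail leaves a value within (1 + e)^k - 1 of 1 whatever the first state, and the first sum
    turns this error into (1 + e) ((1 + e)^k - 1) + e. *)
Lemma chain_sum (e : R) k (p : nat -> U -> U -> R) (S : nat -> pred U) y0 :
    0 <= e -> (forall i x y, 0 <= p i x y) -> S 0%N y0 ->
    (forall i y, (i < k)%N -> S i y -> `|\sum_(x | S i.+1 x) p i x y - 1| <= e) ->
  `|\sum_(X : {ffun 'I_k -> U} | [forall i : 'I_k, S i.+1 (X i)])
      \prod_(i < k) p i (X i) (nth y0 (y0 :: codom X) i) - 1| <= (1 + e) ^+ k - 1.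
Proof.
move=> e_ge0; elim: k p S y0 => [|k IHk] p S y0 p_ge0 Sy0 step.
  rewrite (bigD1 [ffun=> y0]) /=; last by apply/forallP => -[].
  rewrite big_ord0 big1 ?addr0 ?subrr ?normr0 // => X /andP[_ /eqP[]].
  by apply/ffunP => -[].
rewrite big_mkcond big_fcons.
pose Q u := \sum_(X : {ffun 'I_k -> U} | [forall i : 'I_k, S i.+2 (X i)])
      \prod_(i < k) p i.+1 (X i) (nth u (u :: codom X) i).
have -> : \sum_u \sum_(g : {ffun 'I_k -> U})
    (if [forall i : 'I_k.+1, S i.+1 (fcons u g i)] then
       \prod_(i < k.+1) p i (fcons u g i) (nth y0 (y0 :: codom (fcons u g)) i)
     else 0) = \sum_(u | S 1%N u) p 0%N u y0 * Q u.
  rewrite [RHS]big_mkcond; apply: eq_bigr => u _.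
  have forallE g : [forall i : 'I_k.+1, S i.+1 (fcons u g i)]
      = S 1%N u && [forall i : 'I_k, S i.+2 (g i)].
    apply/forallP/andP => [Sg|[Su /forallP Sg] i].
      split; first by have := Sg ord0; rewrite fcons0.
      by apply/forallP => i; have := Sg (lift ord0 i); rewrite fconsS.
    case: (unliftP ord0 i) => [j|] ->; first by rewrite fconsS; apply: Sg.
    by rewrite fcons0.
  case: ifP => Su; last by rewrite big1 // => g _; rewrite forallE Su.
  rewrite /Q mulr_sumr [RHS]big_mkcond; apply: eq_bigr => g _.
  rewrite forallE Su /=; case: ifP => // _.
  rewrite big_ord_recl fcons0 codom_fcons; congr (_ * _); apply: eq_bigr => i _.
  (* Dropping the head changes the default of [nth] from y0 to u, but the index stays in range. *)
  rewrite fconsS; congr p; apply: set_nth_default.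
  by rewrite /= size_codom card_ord; apply: leqW (ltn_ord (lift ord0 i)).
have Qbound u : S 1%N u -> `|Q u - 1| <= (1 + e) ^+ k - 1.
  move=> Su; apply: (IHk (fun i => p i.+1) (fun i => S i.+1)) => // i y lt_ik.
  exact: step.
have step0 := step 0%N y0 isT Sy0.
have -> : \sum_(u | S 1%N u) p 0%N u y0 * Q u - 1
    = \sum_(u | S 1%N u) p 0%N u y0 * (Q u - 1) + (\sum_(u | S 1%N u) p 0%N u y0 - 1).
  rewrite addrA; congr (_ - _); rewrite -big_split /=; apply: eq_bigr => u _.
  by rewrite mulrBr mulr1 subrK.
have -> : (1 + e) ^+ k.+1 - 1 = (1 + e) * ((1 + e) ^+ k - 1) + e by rewrite exprS; ring.
apply: le_trans (ler_normD _ _) _; apply: lerD => //.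
apply: le_trans (ler_norm_sum _ _ _) _.
apply: (@le_trans _ _ (\sum_(u | S 1%N u) p 0%N u y0 * ((1 + e) ^+ k - 1))).
  apply: ler_sum => u Su; rewrite normrM ger0_norm // ler_wpM2l //.
  exact: Qbound.
rewrite -mulr_suml ler_wpM2r //; first by rewrite subr_ge0 exprn_ege1 // lerDl.
by move: step0; rewrite ler_norml => /andP[_]; lra.
Qed.

End ChainSum.

(** * Surjections from the cokernel *)

(** The hypotheses are arguments of this alias so that the module instances declared on it can
    depend on them. In additive notation Z/a acts by powers. *)
Definition zmodof (gT : finGroupType) (a : nat) (a_gt1 : (1 < a)%N)
  (abG : abelian [set: gT]) (expG : (exponent [set: gT] %| a)%N) : Type := gT.

Section Zmodof.
Variables (gT : finGroupType) (a : nat) (a_gt1 : (1 < a)%N).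
Variables (abG : abelian [set: gT]) (expG : (exponent [set: gT] %| a)%N).
Local Notation W := (zmodof a_gt1 abG expG).
HB.instance Definition _ := Finite.on W.
Fact zmodof_addC : commutative (fun x y : W => (x * y)%g : W).
Proof. by move=> x y; apply: (centsP abG); rewrite inE. Qed.
HB.instance Definition _ := GRing.isZmodule.Build W
  (@mulgA gT) zmodof_addC (@mul1g gT) (@mulVg gT).
Definition zmodof_scale (r : 'Z_a) (x : W) : W := (x ^+ r)%g.
Lemma zmodof_expg_mod (x : W) m : (x ^+ (m %% (Zp_trunc a).+2) = x ^+ m)%g.
Proof.
rewrite Zp_cast //; apply: expg_mod.
by apply/eqP; rewrite -order_dvdn; apply: dvdn_trans expG; apply: dvdn_exponent; rewrite inE.
Qed.
Fact zmodof_scaleA r s x : zmodof_scale r (zmodof_scale s x) = zmodof_scale (r * s) x.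
Proof. by rewrite /zmodof_scale zmodof_expg_mod mulnC expgM. Qed.
Fact zmodof_scale1 : left_id 1 zmodof_scale.
Proof. by move=> x; rewrite /zmodof_scale expg1. Qed.
Fact zmodof_scaleDr : right_distributive zmodof_scale +%R.
Proof. by move=> r x y; apply: expgMn; apply: zmodof_addC. Qed.
Fact zmodof_scaleDl x : {morph zmodof_scale^~ x : r s / r + s}.
Proof. by move=> r s; rewrite /zmodof_scale zmodof_expg_mod expgD. Qed.
HB.instance Definition _ := GRing.Zmodule_isLmodule.Build 'Z_a W
  zmodof_scaleA zmodof_scale1 zmodof_scaleDr zmodof_scaleDl.
Definition abmodule : finLmodType 'Z_a := W.
End Zmodof.

Lemma mxact_unit_eq0 (a n : nat) (V : finLmodType 'Z_a) (A : 'M['Z_a]_n)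
    (X : {ffun 'I_n -> V}) : A \in unitmx ->
  (mxact A X == [ffun=> 0]) = (X == [ffun=> 0]).
Proof.
move=> uA; apply/eqP/eqP => [AX0|->]; last exact: mxact0.
by rewrite -[X]mxact1 -(mulVmx uA) mxactM AX0 mxact0.
Qed.

(* Over Z, a matrix and its transpose have the same Smith normal form; this
   descends to Z/a by lifting the entries. *)
Lemma trmx_equivalent (a n : nat) (B : 'M['Z_a]_n) :
  exists P Q : 'M['Z_a]_n, [/\ P \in unitmx, Q \in unitmx & B^T = P *m B *m Q].
Proof.
pose B' : 'M[int]_n := map_mx (fun z : 'Z_a => (z : nat)%:Z) B.
have [L uL [U uU [d _ defB']]] := int_Smith_normal_form B'.
set D := \matrix_(i, j) _ in defB'.
pose f : {rmorphism int -> 'Z_a} := intr.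
have fB : B = map_mx f B'.
  by apply/matrixP => i j; rewrite !mxE /= -[LHS]natr_Zp pmulrn.
have unitf (M : 'M[int]_n) : M \in unitmx -> map_mx f M \in unitmx.
  by rewrite !unitmxE det_map_mx; apply: rmorph_unit.
have DT : (map_mx f D)^T = map_mx f D.
  by apply/matrixP => i j; rewrite !mxE eq_sym; case: eqP => // ->.
exists ((map_mx f U)^T *m invmx (map_mx f L)), (invmx (map_mx f U) *m (map_mx f L)^T).
rewrite !unitmx_mul !unitmx_inv !unitmx_tr !unitf //; split=> //.
have -> : B = map_mx f L *m map_mx f D *m map_mx f U.
  by rewrite fB defB' !map_mxM.
rewrite !trmx_mul DT !mulmxA.
by rewrite mulmxKV ?unitf // -!mulmxA mulKVmx ?unitf // !mulmxA mulmxK ?unitf.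
Qed.

Section Extend.
Variables (a n : nat) (V : finLmodType 'Z_a).

Definition extend (f : {ffun 'I_n -> V}) (v : 'cV['Z_a]_n) : V :=
  \sum_c v c 0 *: f c.

Lemma extendD f u v : extend f (u + v) = extend f u + extend f v.
Proof.
by rewrite -big_split; apply: eq_bigr => c _; rewrite mxE scalerDl.
Qed.

Lemma extend_delta f c : extend f (delta_mx c 0) = f c.
Proof.
rewrite /extend (bigD1 c) //= mxE !eqxx scale1r big1 ?addr0 // => r /negPf nrc.
by rewrite mxE nrc scale0r.
Qed.

(** Composing the homomorphism given by f with B acts on the images of the basis by B^T, hence the
    transpose in [card_Sur_trmx]. *)
Lemma extend_mul (B : 'M['Z_a]_n) f v : extend f (B *m v) = \sum_r v r 0 *: mxact B^T f r.
Proof.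
rewrite /extend; under eq_bigr do rewrite mxE scaler_suml.
rewrite exchange_big; apply: eq_bigr => r _ /=.
rewrite ffunE scaler_sumr; apply: eq_bigr => c _.
by rewrite mxE scalerA mulrC.
Qed.

Lemma extend_span (f : {ffun 'I_n -> V}) x :
  reflect (exists v, extend f v = x) (x \in span f).
Proof.
apply: (iffP idP) => [|[v <-]]; last first.
  by apply: sum_group => c _; apply/scale_group/mem_span.
pose E := [set extend f v | v : 'cV['Z_a]_n].
have groupE : group_set E.
  apply/group_setP; split.
    by apply/imsetP; exists 0; rewrite // /extend big1 // => c _; rewrite mxE scale0r.
  move=> _ _ /imsetP[u _ ->] /imsetP[v _ ->]; apply/imsetP.
  by exists (u + v); rewrite ?extendD.
have : span f \subset Group groupE.
  rewrite span_sub; apply/forallP => c; apply/imsetP.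
  by exists (delta_mx c 0); rewrite ?extend_delta.
by move/fintype.subsetP => sE /sE /imsetP[v _ ->]; exists v.
Qed.

End Extend.

Section Cokernel.
Variables (gT : finGroupType) (a : nat) (a_gt1 : (1 < a)%N).
Variables (abG : abelian [set: gT]) (expG : (exponent [set: gT] %| a)%N).
Local Notation V := (abmodule a_gt1 abG expG).
Variables (n : nat) (B : 'M['Z_a]_n).

Lemma coker_norm (v : 'cV['Z_a]_n) : v \in 'N(mximg B)%g.
Proof.
by apply: (fintype.subsetP (cent_sub _)); apply/centP => y _; apply: FinRing.zmod_mulgC.
Qed.

Lemma Sur_coker_extend (phi : {ffun coker B -> gT}) v :
    phi \in Sur (coker B) gT ->
  phi (coset (mximg B) v)
  = extend [ffun c => phi (coset (mximg B) (delta_mx c 0)) : V] v.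
Proof.
rewrite inE => /andP[/forallP phiM _].
pose h (u : 'cV['Z_a]_n) : V := phi (coset (mximg B) u).
have hD u w : h (u + w) = h u + h w.
  rewrite /h -[RHS](eqP (forallP (phiM _) _)); congr (phi _).
  by rewrite -morphM ?coker_norm.
have h0 : h 0 = 0 by apply: (addrI (h 0)); rewrite -hD !addr0.
have hn u m : h (u *+ m) = h u *+ m.
  by elim: m => [|m IHm]; rewrite ?mulr0n // !mulrS hD IHm.
have hsum (F : 'I_n -> 'cV['Z_a]_n) : h (\sum_c F c) = \sum_c h (F c).
  exact: (big_morph h hD h0).
rewrite -/(h v) [in LHS](_ : v = \sum_c v c 0 *: delta_mx c 0).
  rewrite hsum; apply: eq_bigr => c _; rewrite ffunE -/(h _).
  by rewrite -[v c 0]natr_Zp !scaler_nat hn.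
apply/matrixP => i j; rewrite ord1 summxE (bigD1 i) //= !mxE !eqxx mulr1.
by rewrite big1 ?addr0 // => r /negPf nri; rewrite !mxE eq_sym nri mulr0.
Qed.

(** A surjection is given by the images f of the basis vectors: surjectivity says that f generates,
    and vanishing on the image of B that B^T f = 0. *)
Lemma card_Sur_trmx : #|Sur (coker B) gT|
  = #|[set f : {ffun 'I_n -> V} | (span f == [set: V] :> {set V}) && (mxact B^T f == [ffun=> 0])]|.
Proof.
pose Phi (phi : {ffun coker B -> gT}) : {ffun 'I_n -> V} :=
  [ffun c => phi (coset (mximg B) (delta_mx c 0))].
rewrite -(card_in_imset (f := Phi) (D := Sur (coker B) gT)); last first.
  move=> phi psi Sphi Spsi eqPhi; apply/ffunP => x.
  have [v _ ->] := cosetP x.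
  by rewrite !Sur_coker_extend // -/(Phi phi) eqPhi.
apply: eq_card => f; apply/imsetP/idP => [[phi Sphi ->]|].
  rewrite inE; apply/andP; split.
    rewrite finset.eqEsubset finset.subsetT /=; apply/fintype.subsetP => b _; apply/extend_span.
    have := Sphi; rewrite inE => /andP[_ /forallP/(_ b)/existsP[x /eqP <-]].
    have [v _ ->] := cosetP x.
    by exists v; rewrite -Sur_coker_extend.
  apply/eqP/ffunP => r; rewrite [RHS]ffunE.
  have := extend_mul B (Phi phi) (delta_mx r 0); rewrite -Sur_coker_extend //.
  rewrite coset_id; last by apply/imsetP; exists (delta_mx r 0).
  rewrite (bigD1 r) //= mxE !eqxx scale1r big1 ?addr0; last first.
    by move=> i /negPf nir; rewrite mxE nir scale0r.
  move=> <-; have := Sphi; rewrite inE => /andP[/forallP/(_ 1%g)/forallP/(_ 1%g) /eqP phi1 _].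
  by apply: (mulgI (phi 1%g)); rewrite -phi1 mulg1 [RHS]mulg1.
rewrite inE => /andP[/eqP genf /eqP Bf0].
(* The choice of representatives does not matter, as [extend f] vanishes on the image of B. *)
pose phi : {ffun coker B -> gT} := [ffun x : coker B => extend f (repr x) : gT].
have phiE v : phi (coset (mximg B) v) = extend f v.
  have := mem_repr_coset (coset (mximg B) v).
  rewrite ffunE val_coset ?coker_norm // => /rcosetP[_ /imsetP[u _ ->] ->].
  have -> : (B *m u * v)%g = B *m u + v by [].
  rewrite extendD extend_mul big1 ?add0r // => r _.
  by rewrite Bf0 ffunE scaler0.
exists phi; last by apply/ffunP => c; rewrite ffunE phiE extend_delta.
rewrite inE; apply/andP; split.
  apply/forallP => x; apply/forallP => y.
  have [u _ ->] := cosetP x; have [v _ ->] := cosetP y.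
  rewrite -morphM ?coker_norm // !phiE -[X in _ == X]extendD //.
apply/forallP => b; have : (b : V) \in span f by rewrite genf inE.
by case/extend_span => v <-; apply/existsP; exists (coset (mximg B) v); rewrite phiE.
Qed.

(** With B^T = P B Q and P, Q invertible, f -> Q f carries the generating vectors killed by B^T onto
    those killed by B. *)
Lemma card_Sur_coker : #|Sur (coker B) gT|
  = #|[set f : {ffun 'I_n -> V} | (span f == [set: V] :> {set V}) && (mxact B f == [ffun=> 0])]|.
Proof.
have [P [Q [uP uQ BT]]] := trmx_equivalent B.
rewrite card_Sur_trmx -(card_imset _ (f := mxact Q)); last first.
  by move=> f g eqQ; rewrite -[f]mxact1 -[g]mxact1 -(mulVmx uQ) !mxactM eqQ.
apply: eq_card => f; apply/imsetP/idP => [[g]|].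
  rewrite !inE BT !mxactM mxact_unit_eq0 // => /andP[/eqP gen Bg ->].
  by rewrite span_mxact_unit // gen eqxx.
rewrite inE => /andP[/eqP gen Bf]; exists (mxact (invmx Q) f).
  rewrite !inE BT span_mxact_unit ?unitmx_inv // gen eqxx /=.
  by rewrite -mxactM -mulmxA mulmxV // mulmx1 mxactM mxact_unit_eq0.
by rewrite -mxactM mulmxV // mxact1.
Qed.

End Cokernel.

(** * Chains in a direct sum *)

Lemma nth_codom_ord (T : Type) n (f : 'I_n -> T) y (i : 'I_n) :
  nth y (codom f) i = f i.
Proof.
by rewrite /codom /image_mem (nth_map i) ?nth_ord_enum // size_enum_ord.
Qed.

Lemma card_dffun_sets (I : finType) (T : I -> finType) (S : forall i, {set T i}) :
  #|[set f : {dffun forall i, T i} | [forall i, f i \in S i]]| = (\prod_i #|S i|)%N.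
Proof.
transitivity #|(family (fun i => mem (S i) : pred (T i)) : simpl_pred {dffun forall i, T i})|.
  by apply: eq_card => f; rewrite inE; apply/forallP/familyP.
rewrite card_family foldrE big_map enumT /=.
by apply: eq_bigr => i _; apply: eq_card.
Qed.

Section DirectSum.
Variables (a k : nat) (W : finLmodType 'Z_a) (Z : 'I_k -> finLmodType 'Z_a).
Variables (coord : forall i, W -> Z i) (of_coords : (forall i, Z i) -> W).
Hypothesis coordD : forall i x y, coord i (x + y) = coord i x + coord i y.
Hypothesis coordZ : forall i (r : 'Z_a) x, coord i (r *: x) = r *: coord i x.
Hypothesis coordP : forall x y, (forall i, coord i x = coord i y) -> x = y.
Hypothesis of_coordsK : forall f i, coord i (of_coords f) = f i.

Lemma coord0 i : coord i 0 = 0.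
Proof. by apply: (addrI (coord i 0)); rewrite -coordD !addr0. Qed.

Lemma coord_sum i I (s : seq I) (P : pred I) (F : I -> W) :
  coord i (\sum_(t <- s | P t) F t) = \sum_(t <- s | P t) coord i (F t).
Proof. exact: (big_morph _ (@coordD i) (coord0 i)). Qed.

Definition proj_ge (m : nat) (x : W) : W :=
  of_coords (fun i => if (m <= i)%N then coord i x else 0).

Lemma coord_proj_ge m x i :
  coord i (proj_ge m x) = if (m <= i)%N then coord i x else 0.
Proof. exact: of_coordsK. Qed.

Section Vectors.
Variable n : nat.
Local Notation U := {ffun 'I_n -> W}.

Definition vcoord i (X : U) : {ffun 'I_n -> Z i} := [ffun c => coord i (X c)].

Lemma vcoord_mxact i A (X : U) : vcoord i (mxact A X) = mxact A (vcoord i X).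
Proof.
apply/ffunP => c; rewrite !ffunE coord_sum.
by apply: eq_bigr => r _; rewrite coordZ ffunE.
Qed.

Definition vproj_ge m (X : U) : U := [ffun c => proj_ge m (X c)].

Lemma vcoordP (X Y : U) : (forall i, vcoord i X = vcoord i Y) -> X = Y.
Proof.
move=> eqXY; apply/ffunP => c; apply: coordP => i.
by have /ffunP/(_ c) := eqXY i; rewrite !ffunE.
Qed.

Lemma vcoord_vproj_ge m X i :
  vcoord i (vproj_ge m X) = if (m <= i)%N then vcoord i X else [ffun=> 0].
Proof.
by apply/ffunP => c; rewrite !ffunE coord_proj_ge; case: ifP; rewrite ffunE.
Qed.

Definition of_vcoords (f : forall i, {ffun 'I_n -> Z i}) : U :=
  [ffun c => of_coords (fun i => f i c)].

Lemma of_vcoordsK f i : vcoord i (of_vcoords f) = f i.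
Proof. by apply/ffunP => c; rewrite !ffunE of_coordsK. Qed.

End Vectors.

Definition supported_ge (m : nat) (H : {group W}) :=
  [forall x in H, [forall i : 'I_k, (i < m)%N ==> (coord i x == 0)]].

Definition full_at i (H : {group W}) := [forall b : Z i, [exists x in H, coord i x == b]].

Lemma full_at_span n i (X : {ffun 'I_n -> W}) :
  full_at i (span X) = (span (vcoord i X) == [set: Z i] :> {set Z i}).
Proof.
have coord_extend v : coord i (extend X v) = extend (vcoord i X) v.
  by rewrite coord_sum; apply: eq_bigr => c _; rewrite coordZ ffunE.
apply/forallP/eqP => [full|gen b].
  apply/setP => b; rewrite [RHS]inE; have /existsP[x /andP[]] := full b.
  by case/extend_span=> v <- /eqP <-; rewrite coord_extend; apply/extend_span; exists v.
have : b \in span (vcoord i X) by rewrite gen inE.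
case/extend_span => v <-; apply/existsP; exists (extend X v).
by rewrite coord_extend eqxx andbT; apply/extend_span; exists v.
Qed.

Lemma supported_ge_span n m (X : {ffun 'I_n -> W}) :
  supported_ge m (span X)
  = [forall i : 'I_k, (i < m)%N ==> (vcoord i X == [ffun=> 0])].
Proof.
apply/forall_inP/forallP => [supp i|supp x].
  apply/implyP => lt_im; apply/eqP/ffunP => c; rewrite !ffunE.
  by have /forallP/(_ i)/implyP/(_ lt_im)/eqP := supp _ (mem_span X c).
case/extend_span=> v <-; apply/forallP => i; apply/implyP => lt_im.
have /implyP/(_ lt_im)/eqP/ffunP Xi0 := supp i.
rewrite coord_sum big1 // => c _; rewrite coordZ.
by have := Xi0 c; rewrite !ffunE => ->; rewrite scaler0.
Qed.

(** The coordinate form of [is_chain]. The last index has no clause of its own: there the support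
    and surjectivity conditions already force the group to be the whole last summand. *)
Definition zchain (H : {ffun 'I_k -> {group W}}) : bool :=
  [forall i : 'I_k, [&& supported_ge i (H i), full_at i (H i) &
     [forall j : 'I_k, (j == i.+1 :> nat) ==> [forall x in H i, proj_ge j x \in H j]]]].

Section Products.
Variables (n : nat) (A : 'I_k -> 'M['Z_a]_n).
Local Notation U := {ffun 'I_n -> W}.

Definition valid (i : 'I_k) (X : U) := supported_ge i (span X) && full_at i (span X).

(* At [i = 0] the [nth] below is its head, the zero vector, so the condition reads
   [A_0 X_0 = 0]; at [i > 0] it is [X_(i-1)]. *)
Definition chain_vectors : {set {ffun 'I_k -> U}} :=
  [set X : {ffun 'I_k -> U} | [forall i : 'I_k, valid i (X i) &&
     (mxact (A i) (X i) == vproj_ge i (nth [ffun=> 0] ([ffun=> 0] :: codom X) i))]].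

(** The bounds are natural numbers so that the product from i + 1 to i makes sense, as an empty
    product, even when i + 1 = k. *)
Definition partial_prod (m l : nat) : 'M['Z_a]_n :=
  \prod_(m <= j < l.+1) odflt 1 (omap A (insub j)).

Lemma partial_prod0 (i : 'I_k) : partial_prod 0 i = \prod_(j < k | (j <= i)%N) A j.
Proof.
rewrite /partial_prod (big_nat_widen _ _ k) ?ltn_ord // big_mkord.
by apply: eq_big => [j|j _]; rewrite ?ltnS //= valK.
Qed.

Lemma partial_prod_step (i j : 'I_k) : (i <= j)%N ->
  partial_prod i j = A i *m partial_prod i.+1 j.
Proof. by move=> le_ij; rewrite /partial_prod big_ltn //= valK. Qed.

Definition killed_tuple : {set U} := [set F : U | [forall i : 'I_k,
  (span (vcoord i F) == [set: Z i] :> {set Z i})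
  && (mxact (partial_prod 0 i) (vcoord i F) == [ffun=> 0])]].

Definition killed_coord (i : 'I_k) : {set {ffun 'I_n -> Z i}} :=
  [set f : {ffun 'I_n -> Z i} | (span f == [set: Z i] :> {set Z i})
      && (mxact (partial_prod 0 i) f == [ffun=> 0])].

Lemma card_killed_tuple : #|killed_tuple| = (\prod_(i < k) #|killed_coord i|)%N.
Proof.
pose T i : finType := {ffun 'I_n -> Z i}.
rewrite -(@card_dffun_sets _ T killed_coord).
pose Phi (F : U) : {dffun forall i, T i} := [ffun i => vcoord i F : T i].
have injPhi : injective Phi.
  by move=> F F' /ffunP eqF; apply: vcoordP => i; have := eqF i; rewrite !ffunE.
rewrite -(card_imset _ injPhi); apply: eq_card => f; rewrite [in RHS]inE.
apply/imsetP/forallP => [[F kF ->] i|Sf].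
  by rewrite ffunE; move: kF; rewrite inE => /forallP/(_ i) ?; rewrite inE.
exists (of_vcoords f); last by apply/ffunP => i; rewrite ffunE of_vcoordsK.
by rewrite inE; apply/forallP => i; have := Sf i; rewrite !inE of_vcoordsK.
Qed.

(* The component j of [tails F i] is [A_(i+1) ... A_j F_j], where F_j is the
   component j of [F]. *)
Definition tails (F : U) : {ffun 'I_k -> U} :=
  [ffun i : 'I_k => of_vcoords (fun j : 'I_k =>
     if (i <= j)%N then mxact (partial_prod i.+1 j) (vcoord j F) else [ffun=> 0])].

Lemma vcoord_tails F (i j : 'I_k) : vcoord j (tails F i) =
  if (i <= j)%N then mxact (partial_prod i.+1 j) (vcoord j F) else [ffun=> 0].
Proof. by rewrite ffunE of_vcoordsK. Qed.

Lemma vcoord_tails_diag F i : vcoord i (tails F i) = vcoord i F.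
Proof. by rewrite vcoord_tails leqnn /partial_prod big_geq // mxact1. Qed.

(** The inverse of [tails] keeps the diagonal components. The relations at positive indices recover
    component j of X_i from that of X_j, by induction on j - i, and A_0 X_0 = 0 says that every F_j
    is killed. *)
Lemma card_chain_vectors : #|chain_vectors| = #|killed_tuple|.
Proof.
rewrite -(card_imset _ (f := tails)); last first.
  move=> F F' eqF; apply: vcoordP => i.
  by rewrite -[LHS]vcoord_tails_diag eqF vcoord_tails_diag.
apply: eq_card => X; apply/idP/imsetP => [|[F kF ->]]; last first.
  rewrite inE; apply/forallP => i; apply/andP; split.
    rewrite /valid supported_ge_span full_at_span vcoord_tails_diag.
    apply/andP; split; last by move: kF; rewrite inE => /forallP/(_ i)/andP[].
    by apply/forallP => j; apply/implyP => lt_ji; rewrite vcoord_tails leqNgt lt_ji.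
  apply/eqP/vcoordP => j; rewrite vcoord_mxact vcoord_vproj_ge vcoord_tails.
  case: leqP => [le_ij|_]; last exact: mxact0.
  rewrite -mxactM -partial_prod_step //.
  case: i le_ij => [[|i] lt_ik] /= le_ij.
    have -> : vcoord j [ffun=> 0] = [ffun=> 0].
      by move=> m; apply/ffunP => c; rewrite !ffunE coord0.
    by move: kF; rewrite inE => /forallP/(_ j)/andP[_ /eqP].
  have -> : nth [ffun=> 0] (codom (tails F)) i = tails F (Ordinal (ltnW lt_ik)).
    by rewrite -[X in nth _ _ X]/(nat_of_ord (Ordinal (ltnW lt_ik))) nth_codom_ord.
  by rewrite vcoord_tails /= ltnW.
rewrite inE => /forallP chX.
have nthX (i : 'I_k) (lt_ik : (i.+1 < k)%N) :
    nth [ffun=> 0] ([ffun=> 0] :: codom X) (Ordinal lt_ik) = X i.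
  exact: nth_codom_ord.
have tailX (j i : 'I_k) : (i <= j)%N ->
    vcoord j (X i) = mxact (partial_prod i.+1 j) (vcoord j (X j)).
  move=> le_ij; have [d dE] : exists d, (j - i = d)%N by exists (j - i)%N.
  elim: d i le_ij dE => [|d IHd] i le_ij dE.
    have -> : i = j by apply/val_inj/eqP; rewrite eqn_leq le_ij -subn_eq0 dE.
    by rewrite /partial_prod big_geq // mxact1.
  have lt_ij : (i < j)%N by rewrite -subn_gt0 dE.
  have lt_ik : (i.+1 < k)%N by apply: leq_ltn_trans (ltn_ord j).
  have /andP[_ /eqP stepX] := chX (Ordinal lt_ik).
  rewrite nthX in stepX.
  have := congr1 (vcoord j) stepX; rewrite vcoord_vproj_ge /= lt_ij => <-.
  rewrite vcoord_mxact IHd //=; last by rewrite subnS dE.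
  by rewrite -mxactM -(partial_prod_step (i := Ordinal lt_ik)).
exists (of_vcoords (fun i => vcoord i (X i))).
  rewrite inE; apply/forallP => j; rewrite of_vcoordsK.
  have /andP[/andP[_ fullX] _] := chX j; rewrite -full_at_span fullX /=.
  have k_gt0 : (0 < k)%N by apply: leq_ltn_trans (ltn_ord j).
  have := @partial_prod_step (Ordinal k_gt0) j; rewrite /= => -> //.
  have := @tailX j (Ordinal k_gt0); rewrite mxactM /= => <- //.
  have /andP[_ /eqP/(congr1 (vcoord j))] := chX (Ordinal k_gt0).
  rewrite vcoord_mxact vcoord_vproj_ge /= => ->.
  by apply/eqP/ffunP => c; rewrite !ffunE coord0.
apply/ffunP => i; apply: vcoordP => j; rewrite vcoord_tails of_vcoordsK.
case: leqP => [/tailX //|lt_ji].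
have /andP[/andP[+ _] _] := chX i; rewrite supported_ge_span => /forallP/(_ j).
by rewrite lt_ji => /eqP.
Qed.

End Products.

Lemma proj_geD m x y : proj_ge m (x + y) = proj_ge m x + proj_ge m y.
Proof.
apply: coordP => i; rewrite coordD !coord_proj_ge.
by case: ifP => _; rewrite ?coordD ?addr0.
Qed.

Lemma proj_geZ m (r : 'Z_a) x : proj_ge m (r *: x) = r *: proj_ge m x.
Proof.
apply: coordP => i; rewrite coordZ !coord_proj_ge.
by case: ifP => _; rewrite ?coordZ ?scaler0.
Qed.

Lemma proj_ge0 m : proj_ge m 0 = 0.
Proof. by apply: coordP => i; rewrite coord_proj_ge coord0 if_same. Qed.

Lemma proj_ge_sum m I (s : seq I) (P : pred I) (F : I -> W) :
  proj_ge m (\sum_(t <- s | P t) F t) = \sum_(t <- s | P t) proj_ge m (F t).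
Proof. exact: (big_morph _ (@proj_geD m) (proj_ge0 m)). Qed.

Section Expectation.
Variables (R : realFieldType) (q : 'Z_a -> R) (n : nat) (e : R).
Hypotheses (q_ge0 : forall r, 0 <= q r) (e_ge0 : 0 <= e).
Hypothesis moment : forall (H : {group W}) (Y : 'I_n -> W), (forall c, Y c \in H) ->
  `|\sum_(X : {ffun 'I_n -> W} | span X == H) \prod_c law q (codom X) (Y c) - 1| <= e.

Local Notation U := {ffun 'I_n -> W}.
Let p (i : nat) (x y : U) : R := \prod_c law q (codom x) (vproj_ge i y c).
Let prev (X : {ffun 'I_k -> U}) (i : 'I_k) : U :=
  nth [ffun=> 0] ([ffun=> 0] :: codom X) i.

Lemma prevS (X : {ffun 'I_k -> U}) (i j : 'I_k) : j = i.+1 :> nat -> prev X j = X i.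
Proof. by rewrite /prev => -> /=; apply: nth_codom_ord. Qed.

(** For fixed X the conditions bear on different matrices, so the sum over A factors into sums
    evaluated by [sum_mxweight]. *)
Lemma sum_card_chain_vectors :
  \sum_(A : {ffun 'I_k -> 'M['Z_a]_n})
     (\prod_i mxweight q (A i)) * #|chain_vectors A|%:R
  = \sum_(X : {ffun 'I_k -> U}) \prod_i ((valid i (X i))%:R * p i (X i) (prev X i)).
Proof.
transitivity (\sum_(A : {ffun 'I_k -> 'M['Z_a]_n}) \sum_(X : {ffun 'I_k -> U})
   \prod_i ((valid i (X i))%:R *
     (mxweight q (A i) * (mxact (A i) (X i) == vproj_ge i (prev X i))%:R))).
  apply: eq_bigr => A _; rewrite -sum1_card natr_sum mulr_sumr big_mkcond.
  apply: eq_bigr => X _; rewrite inE.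
  have -> : \prod_i ((valid i (X i))%:R *
        (mxweight q (A i) * (mxact (A i) (X i) == vproj_ge i (prev X i))%:R))
    = \prod_i mxweight q (A i) * \prod_i (valid i (X i) &&
          (mxact (A i) (X i) == vproj_ge i (prev X i)))%:R.
    rewrite -big_split; apply: eq_bigr => i _ /=.
    by rewrite mulrCA; case: (valid i _); rewrite ?mul1r ?mul0r.
  case: forallP => [allX|/forallP/forallPn[i /negPf nXi]].
    by congr (_ * _); rewrite big1 // => i _; rewrite allX.
  by rewrite [X in _ * X](bigD1 i) //= nXi mul0r mulr0.
rewrite exchange_big; apply: eq_bigr => X _.
rewrite -(bigA_distr_bigA (fun (i : 'I_k) (B : 'M['Z_a]_n) => (valid i (X i))%:R *
     (mxweight q B * (mxact B (X i) == vproj_ge i (prev X i))%:R))).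
by apply: eq_bigr => i _; rewrite -mulr_sumr sum_mxweight.
Qed.

Lemma span_sum_chain (H : {ffun 'I_k -> {group W}}) : zchain H ->
  `|\sum_(X : {ffun 'I_k -> U} | [ffun i => span (X i)] == H)
      \prod_i ((valid i (X i))%:R * p i (X i) (prev X i)) - 1| <= (1 + e) ^+ k - 1.
Proof.
move=> /forallP chH.
(* Indices shift by one: S 0 is the start, the zero vector, and S (m + 1) restricts X_m to vectors
   generating H_m. The chain condition puts the projection of X_(m-1) in H_m, so [moment]
   applies. *)
pose S (m : nat) : pred U := if m is m'.+1 then
   (fun x => if insub m' is Some i then span x == H i else false) else pred1 [ffun=> 0].
have p_ge0 i x y : 0 <= p i x y by apply: prodr_ge0 => c _; apply: law_ge0.
have step m y : (m < k)%N -> S m y -> `|\sum_(x | S m.+1 x) p m x y - 1| <= e.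
  move=> lt_mk Sy; rewrite (eq_bigl (fun x => span x == H (Ordinal lt_mk))).
    apply: moment => c; rewrite ffunE.
    case: m lt_mk Sy => [|m] lt_mk /= Sy.
      by rewrite (eqP Sy) ffunE proj_ge0; apply: (group1 (H _)).
    move: Sy; rewrite insubT; first exact: ltnW.
    move=> lt_m /= /eqP Hy; have /and3P[_ _ /forallP/(_ (Ordinal lt_mk))] := chH (Ordinal lt_m).
    rewrite /= eqxx => /forall_inP; apply; rewrite -Hy; exact: mem_span.
  by move=> x; rewrite /S insubT.
have := chain_sum e_ge0 p_ge0 (eqxx _ : S 0%N [ffun=> 0]) step.
set s1 := \sum_(X | _) _ => h; set s2 := \sum_(X | _) _.
suff -> : s2 = s1 by [].
apply: eq_big => [X|X /eqP/ffunP sX].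
  apply/eqP/forallP => [/ffunP sX i|sX].
    by rewrite /S valK -sX ffunE.
  by apply/ffunP => i; have := sX i; rewrite ffunE /S valK => /eqP.
apply: eq_bigr => i _; rewrite /valid -[span _](ffunE (fun i => span (X i))) sX.
by have /and3P[-> -> _] := chH i; rewrite mul1r.
Qed.

(** If support or surjectivity fails, an indicator vanishes. If the projection condition fails, it
    fails at some entry of X_i, and no combination of the entries of X_(i+1) equals the projection
    of that entry. *)
Lemma span_sum_nonchain (H : {ffun 'I_k -> {group W}}) : ~~ zchain H ->
  \sum_(X : {ffun 'I_k -> U} | [ffun i => span (X i)] == H)
      \prod_i ((valid i (X i))%:R * p i (X i) (prev X i)) = 0.
Proof.
case/forallPn => i nHi; apply: big1 => X /eqP/ffunP sX.
have spanE j : span (X j) = H j by rewrite -sX ffunE.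
move: nHi; rewrite andbA negb_and -spanE -/(valid i (X i)) => /orP[/negPf nv|].
  by rewrite (bigD1 i) //= nv !mul0r.
case/forallPn => j; rewrite negb_imply => /andP[/eqP ji].
case/forall_inPn => x /extend_span[v <-] nHj.
suff [c nHc] : exists c, proj_ge j (X i c) \notin H j.
  rewrite (bigD1 j) //= /p (bigD1 c) //= (law_supp q (K := H j)) ?mul0r ?mulr0 ?mul0r //.
    by move=> _ /codomP[r ->]; rewrite -spanE mem_span.
  by rewrite (prevS X ji) ffunE.
apply/existsP; apply: contraR nHj; rewrite negb_exists => /forallP allc.
rewrite proj_ge_sum; apply: sum_group => c _; rewrite proj_geZ; apply: scale_group.
by rewrite -[_ \in _]negbK; apply: allc.
Qed.

Lemma expected_chain_vectors :
  `|\sum_(A : {ffun 'I_k -> 'M['Z_a]_n})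
     (\prod_i mxweight q (A i)) * #|chain_vectors A|%:R - #|[set H | zchain H]|%:R|
   <= #|{ffun 'I_k -> {group W}}|%:R * ((1 + e) ^+ k - 1).
Proof.
rewrite sum_card_chain_vectors.
rewrite (partition_big (fun X : {ffun 'I_k -> U} => [ffun i => span (X i)]) predT) //=.
have -> : #|[set H | zchain H]|%:R = \sum_H (zchain H)%:R :> R.
  rewrite -sum1_card natr_sum big_mkcond; apply: eq_bigr => H _.
  by rewrite inE; case: (zchain H).
rewrite -sumrB; apply: le_trans (ler_norm_sum _ _ _) _.
rewrite [leRHS]mulr_natl -[leRHS]sumr_const; apply: ler_sum => H _.
have [chH|nchH] := boolP (zchain H); first exact: span_sum_chain.
by rewrite span_sum_nonchain // subrr normr0 subr_ge0 exprn_ege1 // lerDl.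
Qed.

End Expectation.

Lemma expected_chain_vectors_limit (R : realType) (alpha : R) :
    (1 < a)%N -> 0 < alpha -> alpha <= 1 / 2 ->
  exists K c : R, [/\ 0 < K, 0 < c &
    forall (q : 'Z_a -> R) (n : nat), balanced_weights alpha q ->
    `|\sum_(A : {ffun 'I_k -> 'M['Z_a]_n})
       (\prod_i mxweight q (A i)) * #|chain_vectors A|%:R - #|[set H | zchain H]|%:R|
    <= K * expR (- (c * n%:R))].
Proof.
move=> a_gt1 alpha_gt0 alpha_le.
have [C [th [C_ge0 th_gt0 th_lt1 lim]]] := moment_limit W a_gt1 alpha_gt0 alpha_le.
pose N : R := #|{ffun 'I_k -> {group W}}|%:R.
pose K0 : R := N * (k%:R * C * (1 + C) ^+ k).
have K0_ge0 : 0 <= K0 by rewrite !mulr_ge0 ?exprn_ge0 ?addr_ge0 ?ler0n.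
(* The choice c = - ln th turns th^n into e^(-cn); adding 1 to K0 makes the constant positive. *)
exists (K0 + 1), (- ln th); split.
- by rewrite ltr_wpDl.
- by rewrite oppr_gt0 ln_lt0 // th_gt0.
move=> q n q_bal.
have e_ge0 : 0 <= C * th ^+ n by rewrite mulr_ge0 ?exprn_ge0 // ltW.
have q_ge0 r : 0 <= q r by case: q_bal.
apply: le_trans (expected_chain_vectors q_ge0 e_ge0 (lim q q_bal n)) _.
have thn_le1 : th ^+ n <= 1 by rewrite exprn_ile1 // ltW.
have -> : expR (- (- ln th * n%:R)) = th ^+ n.
  by rewrite mulNr opprK mulrC expRM_natl lnK // posrE.
apply: (@le_trans _ _ (K0 * th ^+ n)); last first.
  by rewrite ler_wpM2r ?exprn_ge0 ?(ltW th_gt0) // lerDl.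
rewrite /K0 -/N -[leRHS]mulrA ler_wpM2l ?ler0n //.
apply: le_trans (expr1D_sub1_le _ e_ge0) _.
have -> : k%:R * C * (1 + C) ^+ k * th ^+ n = k%:R * (C * th ^+ n) * (1 + C) ^+ k.
  by ring.
rewrite ler_wpM2l ?mulr_ge0 ?ler0n ?exprn_ge0 ?(ltW th_gt0) //.
apply: lerXn2r; rewrite ?nnegrE ?addr_ge0 //.
by rewrite lerD2l ler_piMr.
Qed.

End DirectSum.

(** * Finite abelian groups as modules over Z/a *)

Section GroupSum.
Variables (k : nat) (G : 'I_k -> finGroupType).
Hypothesis abG : forall i, abelian [set: G i].
Variable a : nat.
Hypotheses (a_gt1 : (1 < a)%N) (expG : forall i, (exponent [set: G i] %| a)%N).

Local Notation sumG := ({dffun forall j : 'I_k, G j} : finGroupType).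

Fact sum_abelian : abelian [set: sumG].
Proof.
apply/centsP => x _ y _; apply/ffunP => i; rewrite !mulg_ffun.
by apply: (centsP (abG i)); rewrite inE.
Qed.

Fact sum_exponent : (exponent [set: sumG] %| a)%N.
Proof.
apply/exponentP => x _; apply/ffunP => i.
have -> : (x ^+ a)%g i = (x i ^+ a)%g.
  by elim: (a) => [|m IHm]; rewrite ?expg0 ?oneg_ffun // !expgS mulg_ffun IHm.
by rewrite oneg_ffun; apply: (exponentP (expG i)); rewrite inE.
Qed.

Definition sum_module : finLmodType 'Z_a := abmodule a_gt1 sum_abelian sum_exponent.
Definition summand i : finLmodType 'Z_a := abmodule a_gt1 (abG i) (expG i).

Definition group_coord i (x : sum_module) : summand i := (x : sumG) i.

Definition of_group_coords (f : forall i, summand i) : sum_module :=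
  [ffun i => f i : G i] : sumG.

Lemma group_coordD i x y :
  group_coord i (x + y) = group_coord i x + group_coord i y.
Proof. exact: (@mulg_ffun _ G i x y). Qed.

Lemma group_coordZ i (r : 'Z_a) x : group_coord i (r *: x) = r *: group_coord i x.
Proof.
have c0 : group_coord i 0 = 0 by exact: (@oneg_ffun _ G i).
rewrite -[r]natr_Zp !scaler_nat; move: (r : nat) => m.
by elim: m => [|m IHm]; rewrite ?mulr0n ?c0 // !mulrS group_coordD IHm.
Qed.

Lemma group_coordP (x y : sum_module) :
  (forall i, group_coord i x = group_coord i y) -> x = y.
Proof. by move=> eqxy; apply/(@ffunP _ _ (x : sumG) y). Qed.

Lemma of_group_coordsK f i : group_coord i (of_group_coords f) = f i.
Proof. by rewrite /group_coord /of_group_coords ffunE. Qed.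

Fact to_module_set (H : {group sumG}) :
  @group_set sum_module ((H : {set sumG}) : {set sum_module}).
Proof.
apply/group_setP; split; first exact: (group1 H).
by move=> x y; exact: (@groupM _ H).
Qed.

Definition to_module (H : {group sumG}) : {group sum_module} := Group (to_module_set H).

Fact of_module_set (H : {group sum_module}) :
  @group_set sumG ((H : {set sum_module}) : {set sumG}).
Proof.
apply/group_setP; split; first exact: (group1 H).
by move=> x y; exact: (@groupM _ H).
Qed.

Definition of_module (H : {group sum_module}) : {group sumG} := Group (of_module_set H).

Lemma of_moduleK : cancel of_module to_module.
Proof. by move=> H; apply/val_inj. Qed.

Lemma to_module_inj : injective to_module.
Proof. by move=> H H' /(congr1 val) eqH; apply/val_inj. Qed.

Lemma supported_to_module m (H : {group sumG}) :
  supported_ge group_coord m (to_module H) = (H \subset psum G [set j : 'I_k | (m <= j)%N]).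
Proof.
apply/forall_inP/fintype.subsetP => supp x Hx; have := supp x Hx.
  move/forallP => suppx; rewrite inE; apply/forallP => j; apply/implyP.
  by rewrite inE -ltnNge => lt_jm; apply: (implyP (suppx j)).
rewrite inE => /forallP suppx; apply/forallP => j; apply/implyP => lt_jm.
by have /implyP := suppx j; apply; rewrite inE -ltnNge.
Qed.

Lemma full_to_module i (H : {group sumG}) :
  full_at group_coord i (to_module H) = ([set x i | x : sumG in H] == [set: G i]).
Proof.
apply/forallP/eqP => [full|full b].
  apply/setP => b; rewrite [RHS]inE.
  have /existsP[x /andP[Hx /eqP <-]] := full b.
  by apply/imsetP; exists x.
have : b \in [set x i | x : sumG in H] by rewrite full inE.
by case/imsetP=> x Hx ->; apply/existsP; exists x; apply/andP; split.
Qed.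

Lemma proj_to_module (i : 'I_k) (x : sumG) :
  proj_ge group_coord of_group_coords i.+1 x
  = (proj_on [set l : 'I_k | (i < l)%N] x : sum_module).
Proof.
apply: group_coordP => j; rewrite (coord_proj_ge of_group_coordsK).
by rewrite /group_coord /proj_on ffunE inE.
Qed.

Lemma is_chain_to_module (H : {ffun 'I_k -> {group sumG}}) :
  is_chain H = zchain group_coord of_group_coords [ffun i => to_module (H i)].
Proof.
apply: eq_forallb => i; rewrite !ffunE supported_to_module full_to_module.
case: eqP => [lastk|_].
  have -> : [forall j : 'I_k, (j == i.+1 :> nat) ==>
      [forall x in to_module (H i), proj_ge group_coord of_group_coords j x \in
         [ffun i0 => to_module (H i0)] j]].
    by apply/forallP => j; apply/implyP => /eqP ji; have := ltn_ord j; rewrite ji lastk ltnn.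
  rewrite andbT; have lei (j : 'I_k) : (i <= j)%N -> j = i.
    move=> le_ij; apply/val_inj/eqP; rewrite eqn_leq le_ij andbT.
    by rewrite -ltnS lastk; apply: (ltn_ord j).
  apply/eqP/andP => [->|[supp /eqP full]].
    split.
      apply/fintype.subsetP => x; rewrite !inE => /forallP px; apply/forallP => j.
      apply/implyP; rewrite inE => nle; have /implyP := px j; apply; rewrite inE.
      by apply: contra nle => /eqP ->.
    apply/eqP/setP => b; rewrite [RHS]inE; apply/imsetP.
    exists (dfung1 b); last by rewrite dfung1_id.
    rewrite inE; apply/forallP => j; apply/implyP; rewrite inE eq_sym => nij.
    by rewrite dfung1_dflt.
  have psumE : psum G [set j : 'I_k | (i <= j)%N] = psum G [set i].
    congr psum; apply/setP => j; rewrite !inE; apply/idP/eqP => [/lei //|->//].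
  rewrite psumE in supp; apply/eqP; rewrite finset.eqEsubset supp /=.
  (* An element supported on i alone is determined by its coordinate at i. *)
  apply/fintype.subsetP => x px; have : x i \in [set x i | x : sumG in H i] by rewrite full inE.
  case/imsetP=> y Hy xyi; suff -> : x = y by [].
  apply/ffunP => j; have [->//|nji] := eqVneq j i.
  have out z : z \in psum G [set i] -> z j = 1%g.
    by rewrite inE => /forallP/(_ j); rewrite inE nji => /eqP.
  by rewrite !out // (fintype.subsetP supp).
congr [&& _, _ & _]; apply: eq_forallb => j; rewrite ffunE.
case: eqP => //= ji; rewrite ji; apply/fintype.subsetP/forall_inP => [sub x Hx|sub _ /imsetP[x Hx ->]].
  by rewrite proj_to_module; apply: sub; apply/imsetP; exists x.
by have := sub x Hx; rewrite proj_to_module.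
Qed.

Lemma card_zchain :
  #|[set H | zchain group_coord of_group_coords H]| = m_chains G.
Proof.
pose f (H : {ffun 'I_k -> {group sumG}}) : {ffun 'I_k -> {group sum_module}} :=
  [ffun i => to_module (H i)].
have injf : injective f.
  move=> H H' /ffunP eqH; apply/ffunP => i; apply: to_module_inj.
  by have := eqH i; rewrite !ffunE.
rewrite /m_chains -(card_imset _ injf); apply/esym/eq_card => H.
apply/imsetP/idP => [[H' chH' ->]|].
  by move: chH'; rewrite !inE is_chain_to_module.
rewrite inE => chH; have eqH : f [ffun i => of_module (H i)] = H.
  by apply/ffunP => i; rewrite !ffunE of_moduleK.
by exists [ffun i => of_module (H i)]; rewrite // inE is_chain_to_module -/(f _) eqH.
Qed.

End GroupSum.

(** * Finite random variables *)

Section FiniteVariables.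
Local Open Scope classical_set_scope.
Variables (d : measure_display) (T : measurableType d) (R : realType).
Variable P : probability T R.

Definition pmf (F : finType) (X : T -> F) (x : F) : R := fine (P [set t | X t = x]).

Lemma pmf_ge0 (F : finType) (X : T -> F) x : 0 <= pmf X x.
Proof. exact: fine_ge0. Qed.

Lemma EFin_pmf (F : finType) (X : T -> F) x : finite_rv X ->
  (pmf X x)%:E = P [set t | X t = x].
Proof. by move=> mX; rewrite fineK //; apply: fin_num_measure. Qed.

Lemma integral_finite_rv (F : finType) (X : T -> F) (g : F -> R) :
    finite_rv X -> (forall x, 0 <= g x) ->
  (\int[P]_t (g (X t))%:E)%E = (\sum_x g x * pmf X x)%:E.
Proof.
move=> mX g_ge0.
have gE t : (g (X t))%:E = (\sum_x (g x * \1_[set t | X t = x] t)%:E)%E.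
  rewrite sumEFin (bigD1 (X t)) //= indicE mem_set // mulr1 big1 ?addr0 // => x nxX.
  by rewrite indicE memNset ?mulr0 // => /= eqx; rewrite eqx eqxx in nxX.
under eq_integral do rewrite gE.
rewrite ge0_integral_sum //; first last.
- by move=> x t _; rewrite lee_fin mulr_ge0.
- by move=> x; apply/measurable_EFinP; apply: measurable_funM.
rewrite -sumEFin; apply: eq_bigr => x _.
rewrite (integralZl_indic _ (fun _ => [set t | X t = x])) //; last first.
  by rewrite ltNge g_ge0.
by rewrite integral_indic // setIT EFinM EFin_pmf.
Qed.

Lemma sum_pmf (F : finType) (X : T -> F) : finite_rv X -> \sum_x pmf X x = 1.
Proof.
move=> mX; apply: EFin_inj.
have := integral_finite_rv mX (fun=> ler01).
rewrite integral_cst //= probability_setT mul1e => ->.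
by congr EFin; apply: eq_bigr => x _; rewrite mul1r.
Qed.

Lemma measurable_finite_rv (F : finType) (X : T -> F) (B : pred F) : finite_rv X ->
  measurable [set t | B (X t)].
Proof.
move=> mX.
have -> : [set t | B (X t)] = \bigcup_(x in [set x | B x]) [set t | X t = x].
  apply/seteqP; split => [t Bt|t [x /= Bx eqX]]; first by exists (X t).
  by rewrite /= eqX.
by apply: fin_bigcup_measurable => // x _; apply: mX.
Qed.

Lemma finite_rv_comp (F F' : finType) (f : F -> F') (X : T -> F) :
  finite_rv X -> finite_rv (fun t => f (X t)).
Proof.
move=> mX y; have := measurable_finite_rv (fun x => f x == y) mX.
by congr measurable; apply/seteqP; split=> t /= /eqP.
Qed.

Lemma prob_finite_rv (F : finType) (X : T -> F) (B : pred F) : finite_rv X ->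
  P [set t | B (X t)] = (\sum_(x | B x) pmf X x)%:E.
Proof.
move=> mX; have mB := measurable_finite_rv B mX.
have := integral_finite_rv mX (g := fun x => (B x)%:R) (fun x => ler0n _ _).
have -> : (\int[P]_t ((B (X t))%:R)%:E)%E = P [set t | B (X t)].
  rewrite -[X in _ = P X]setIT -(integral_indic P measurableT mB).
  apply: eq_integral => t _; rewrite indicE; congr (_%:R)%:E.
  by congr nat_of_bool; apply/idP/idP; rewrite inE.
move=> ->; congr EFin; rewrite [RHS]big_mkcond; apply: eq_bigr => x _.
by case: (B x); rewrite ?mul1r ?mul0r.
Qed.

Lemma finite_rv_ffun (I F : finType) (X : I -> T -> F) : (forall i, finite_rv (X i)) ->
  finite_rv (fun t => [ffun i => X i t]).
Proof.
move=> mX x.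
have -> : [set t | [ffun i => X i t] = x] = \bigcap_(i in [set: I]) [set t | X i t = x i].
  apply/seteqP; split => [t /= <- i _|t Xt] /=; first by rewrite ffunE.
  by apply/ffunP => i; rewrite ffunE; apply: Xt.
by apply: fin_bigcap_measurable => // i _; apply: mX.
Qed.

Lemma pmf_indep (I F : finType) (X : I -> T -> F) (x : {ffun I -> F}) :
    (forall i, finite_rv (X i)) -> indep_rvs P X ->
  pmf (fun t => [ffun i => X i t]) x = \prod_i pmf (X i) (x i).
Proof.
move=> mX indX; apply: EFin_inj; rewrite EFin_pmf; last exact: finite_rv_ffun.
have := indX [set: I]%SET (fun i => [set x i]%SET).
have -> : [set t | forall i, i \in [set: I]%SET -> X i t \in [set x i]%SET]
    = [set t | [ffun i => X i t] = x].
  apply/seteqP; split => t /=.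
    by move=> Xt; apply/ffunP => i; rewrite ffunE; have := Xt i; rewrite !inE => /(_ isT)/eqP.
  by move=> <- i _; rewrite ffunE inE.
move=> ->; rewrite -prodEFin; apply: eq_big => [i|i _]; first by rewrite inE.
by rewrite EFin_pmf //; congr (P _); apply/seteqP; split=> t /=; rewrite inE => /eqP.
Qed.

End FiniteVariables.

Section BalancedVariables.
Variables (d : measure_display) (T : measurableType d) (R : realType).
Variables (P : probability T R) (a : nat) (alpha : R).

Lemma balanced_pmf (xi : T -> 'Z_a) : finite_rv xi -> balanced P alpha xi ->
  balanced_weights alpha (pmf P xi).
Proof.
move=> mxi bal; split; [exact: pmf_ge0 | exact: sum_pmf |].
move=> p c p_pr p_a.
(* In [balanced_weights] c is any natural number, while the maximum in [balanced] runs over residues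
   below p, so c is reduced modulo p. *)
have lt_cp : (c %% p < p)%N by rewrite ltn_mod prime_gt0.
have := bal p p_pr p_a; move/(le_trans _); rewrite -lee_fin; apply.
have := prob_finite_rv P (fun r : 'Z_a => r == c %[mod p])%N mxi.
move=> <-; apply: le_trans (le_bigmax_cond _ _ (isT : xpredT (Ordinal lt_cp))) => /=.
rewrite [leRHS](_ : _ = P [set t | (xi t == c %[mod p])%N]%classic) //.
by congr (P _); apply/seteqP; split=> t /=; rewrite modn_mod; [move=> ->; rewrite eqxx| move=> /eqP].
Qed.

Lemma pmf_matrix n (A : T -> 'M['Z_a]_n) (q : 'Z_a -> R) :
    indep_rvs P (fun (rc : 'I_n * 'I_n) t => A t rc.1 rc.2) ->
    (forall r c, finite_rv (fun t => A t r c)) ->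
    (forall r c, pmf P (fun t => A t r c) =1 q) ->
  forall B, pmf P A B = mxweight q B.
Proof.
move=> indA mA pmfA B.
have := pmf_indep [ffun rc : 'I_n * 'I_n => B rc.1 rc.2] (fun rc => mA rc.1 rc.2) indA.
rewrite /mxweight pair_big => pmfE.
transitivity (pmf P (fun t => [ffun rc : 'I_n * 'I_n => A t rc.1 rc.2])
  [ffun rc : 'I_n * 'I_n => B rc.1 rc.2]).
  congr (fine (P _)); apply/seteqP; split=> t /= [eqA].
    by apply/ffunP => rc; rewrite !ffunE eqA.
  apply/matrixP => r c; have /ffunP/(_ (r, c)) := eqA; by rewrite !ffunE.
by rewrite pmfE; apply: eq_bigr => rc _; rewrite pmfA ffunE.
Qed.

End BalancedVariables.

Theorem theorem4p1 (R : realType) (k a : nat) (alpha : R)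
    (G : 'I_k -> finGroupType)
    (k_ge1 : (1 <= k)%N) (a_ge2 : (2 <= a)%N)
    (alpha_gt0 : 0 < alpha) (alpha_le : alpha <= 1 / 2)
    (abG : forall i, abelian [set: G i])
    (expG : forall i, (exponent [set: G i] %| a)%N) :
  exists K c : R, 0 < K /\ 0 < c /\
    forall n : nat, (1 <= n)%N ->
    forall (d' : measure_display) (T' : measurableType d')
      (Q : probability T' R) (xi : T' -> 'Z_a),
      finite_rv xi -> balanced Q alpha xi ->
    forall (d : measure_display) (T : measurableType d)
      (P : probability T R) (M : 'I_k -> T -> 'M['Z_a]_n),
      (forall i, finite_rv (M i)) ->
      indep_rvs P M ->
      (forall i, indep_rvs P
         (fun (rc : 'I_n * 'I_n) (t : T) => M i t rc.1 rc.2)) ->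
      (forall i (r c : 'I_n),
         identically_distributed P Q (fun t => M i t r c) xi) ->
      (`| 'E_P [fun t => (\prod_(i < k)
             #|Sur (coker (\prod_(j < k | (j <= i)%N) M j t)) (G i)|)%:R]
          - (m_chains G)%:R%:E | <= (K * expR (- (c * n%:R)))%:E)%E.
Proof.
have coordD := @group_coordD k G abG a a_ge2 expG.
have coordZ := @group_coordZ k G abG a a_ge2 expG.
have coordP := @group_coordP k G abG a a_ge2 expG.
have of_coordsK := @of_group_coordsK k G abG a a_ge2 expG.
have limit := expected_chain_vectors_limit coordD coordZ coordP of_coordsK a_ge2 alpha_gt0 alpha_le.
case: limit => K [c].
case=> K_gt0 c_gt0 bound.
(* Both constants are fixed before n and xi, the bound being uniform over balanced weights. *)
exists K, c; split=> //; split=> //.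
move=> n _ d' T' Q xi mxi bal d T P M mM indM indE eqd.
pose q := pmf Q xi; have q_bal : balanced_weights alpha q := balanced_pmf mxi bal.
pose g (A : {ffun 'I_k -> 'M['Z_a]_n}) : R :=
  (\prod_(i < k) #|Sur (coker (\prod_(j < k | (j <= i)%N) A j)) (G i)|)%:R.
have pmfM (A : {ffun 'I_k -> 'M['Z_a]_n}) :
    pmf P (fun t => [ffun i => M i t]) A = \prod_i mxweight q (A i).
  rewrite pmf_indep //; apply: eq_bigr => i _; apply: pmf_matrix => // r c'.
    exact: (finite_rv_comp (fun B : 'M['Z_a]_n => B r c') (mM i)).
  by move=> z; rewrite /q /pmf eqd.
have -> : 'E_P [fun t => (\prod_(i < k)
     #|Sur (coker (\prod_(j < k | (j <= i)%N) M j t)) (G i)|)%:R]%E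
  = (\sum_(A : {ffun 'I_k -> 'M['Z_a]_n}) (\prod_i mxweight q (A i)) * g A)%:E.
  rewrite unlock.
  transitivity (\int[P]_t (g [ffun i => M i t])%:E)%E.
    apply: eq_integral => t _; apply: (congr1 (fun m : nat => (m%:R)%:E)).
    apply: eq_bigr => i _.
    have -> : \prod_(j < k | (j <= i)%N) [ffun j => M j t] j
        = \prod_(j < k | (j <= i)%N) M j t by apply: eq_bigr => j _; rewrite ffunE.
    by [].
  have mJ := finite_rv_ffun mM.
  rewrite (integral_finite_rv P mJ (fun A => ler0n _ _ : 0 <= g A)).
  by congr EFin; apply: eq_bigr => A _; rewrite pmfM mulrC.
rewrite -EFinB lee_fin -(card_zchain abG a_ge2 expG).
(* For each i, surjections onto G_i are counted by killed generating vectors; families of these are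
   killed tuples over the direct sum, which [tails] turns into chain vectors. *)
have gE A : g A = #|chain_vectors (@group_coord k G abG a a_ge2 expG)
     (@of_group_coords k G abG a a_ge2 expG) A|%:R.
  rewrite (card_chain_vectors coordD coordZ coordP of_coordsK).
  rewrite (card_killed_tuple coordP of_coordsK).
  apply: (congr1 (fun m : nat => m%:R)); apply: eq_bigr => i _.
  by rewrite -partial_prod0 (card_Sur_coker a_ge2 (abG i) (expG i)).
under eq_bigr do rewrite gE.
exact: bound.
Qed.
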